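(* Let $k,s\ge 0$ be integers. Then for every $q=x_0+\vec q\in\mathbb H$, $$(Q_k\odot Q_s)(q)=\frac{c_kc_s}{c_{k+s}}\,Q_{k+s}(q),$$ where $\odot$ is the C-K product and $c_l:=\sum_{j=0}^l(-1)^jT^l_j$ for all $l\ge 0$.
   Context: $\mathbb H$ denotes the quaternions, $q=x_0+\vec q$ with $\vec q=x_1i+x_2j+x_3k$, $\overline q=x_0-\vec q$, $|q|=\sqrt{q\overline q}$. For $k\ge 0$, $Q_k(q)=\sum_{j=0}^k T^k_j\,q^{k-j}\overline q^{\,j}$ with $T^k_j=\frac{2(k-j+1)}{(k+1)(k+2)}$. A real differentiable function $f$ on an open subset of $\mathbb H$ is (left) Fueter regular if $\left(\frac{\partial}{\partial x_0}+i\frac{\partial}{\partial x_1}+j\frac{\partial}{\partial x_2}+k\frac{\partial}{\partial x_3}\right)f=0$. The polynomials $Q_k$ are Fueter regular on $\mathbb H$. C-K product: for Fueter regular $f,g$, $f\odot g$ is the Cauchy-Kowalevskaya (C-K) extension of the pointwise product $f(\vec q)g(\vec q)$ of the restrictions of $f,g$ to $x_0=0$, i.e. the unique Fueter regular function whose restriction to $x_0=0$ equals this pointwise product. *)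

(* Defs.v *)
From HB Require Import structures.
From mathcomp Require Import all_boot all_order all_algebra.
From mathcomp Require Import all_classical all_reals all_analysis.
From mathcomp Require Import ring.
Set Implicit Arguments.
Unset Strict Implicit.
Unset Printing Implicit Defensive.
Import Order.TTheory GRing.Theory Num.Theory.
Import numFieldNormedType.Exports.
Local Open Scope classical_set_scope.
Local Open Scope ring_scope.

(* The quaternion x0 + x1 i + x2 j + x3 k is the row vector (x0, x1, x2, x3).
   The normed-module structure is the one of 'rV[R]_4 (sup norm), which is
   equivalent to the Euclidean norm |q| and so yields the same topology and
   the same notion of real differentiability. *)
Definition quat (R : realType) : Type := 'rV[R]_4.

HB.instance Definition _ (R : realType) := NormedModule.on (quat R).
HB.instance Definition _ (R : realType) := Pointed.on (quat R).

Definition mkquat (R : realType) (a b c d : R) : quat R :=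
  \row_(i < 4) [:: a; b; c; d]`_i.

Definition qx0 (R : realType) (q : quat R) : R := q 0 0.
Definition qx1 (R : realType) (q : quat R) : R := q 0 1.
Definition qx2 (R : realType) (q : quat R) : R := q 0 2.
Definition qx3 (R : realType) (q : quat R) : R := q 0 3.

Definition qone (R : realType) : quat R := mkquat 1 0 0 0.
Definition qi (R : realType) : quat R := mkquat 0 1 0 0.
Definition qj (R : realType) : quat R := mkquat 0 0 1 0.
Definition qk (R : realType) : quat R := mkquat 0 0 0 1.

Definition qmul (R : realType) (p q : quat R) : quat R :=
  mkquat
    (qx0 p * qx0 q - qx1 p * qx1 q - qx2 p * qx2 q - qx3 p * qx3 q)
    (qx0 p * qx1 q + qx1 p * qx0 q + qx2 p * qx3 q - qx3 p * qx2 q)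
    (qx0 p * qx2 q - qx1 p * qx3 q + qx2 p * qx0 q + qx3 p * qx1 q)
    (qx0 p * qx3 q + qx1 p * qx2 q - qx2 p * qx1 q + qx3 p * qx0 q).

Definition qconj (R : realType) (q : quat R) : quat R :=
  mkquat (qx0 q) (- qx1 q) (- qx2 q) (- qx3 q).

Lemma quatP (R : realType) (p q : quat R) :
  qx0 p = qx0 q -> qx1 p = qx1 q -> qx2 p = qx2 q -> qx3 p = qx3 q -> p = q.
Proof.
move=> h0 h1 h2 h3; apply/matrixP => a b; rewrite (ord1 a).
case: b => -[|[|[|[|//]]]] hb.
- by have -> : Ordinal hb = 0 :> 'I_4 by apply: val_inj.
- by have -> : Ordinal hb = 1 :> 'I_4 by apply: val_inj.
- by have -> : Ordinal hb = 2 :> 'I_4 by apply: val_inj.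
- by have -> : Ordinal hb = 3 :> 'I_4 by apply: val_inj.
Qed.

Lemma qx0_mk (R : realType) (a b c d : R) : qx0 (mkquat a b c d) = a.
Proof. by rewrite /qx0 mxE. Qed.
Lemma qx1_mk (R : realType) (a b c d : R) : qx1 (mkquat a b c d) = b.
Proof. by rewrite /qx1 mxE. Qed.
Lemma qx2_mk (R : realType) (a b c d : R) : qx2 (mkquat a b c d) = c.
Proof. by rewrite /qx2 mxE. Qed.
Lemma qx3_mk (R : realType) (a b c d : R) : qx3 (mkquat a b c d) = d.
Proof. by rewrite /qx3 mxE. Qed.
Definition qx_mk := (qx0_mk, qx1_mk, qx2_mk, qx3_mk).

Lemma qx0D (R : realType) (p q : quat R) : qx0 (p + q) = qx0 p + qx0 q.
Proof. by rewrite /qx0 mxE. Qed.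
Lemma qx1D (R : realType) (p q : quat R) : qx1 (p + q) = qx1 p + qx1 q.
Proof. by rewrite /qx1 mxE. Qed.
Lemma qx2D (R : realType) (p q : quat R) : qx2 (p + q) = qx2 p + qx2 q.
Proof. by rewrite /qx2 mxE. Qed.
Lemma qx3D (R : realType) (p q : quat R) : qx3 (p + q) = qx3 p + qx3 q.
Proof. by rewrite /qx3 mxE. Qed.
Definition qxD := (qx0D, qx1D, qx2D, qx3D).

Lemma qx0Z (R : realType) (a : R) (q : quat R) : qx0 (a *: q) = a * qx0 q.
Proof. by rewrite /qx0 mxE. Qed.
Lemma qx1Z (R : realType) (a : R) (q : quat R) : qx1 (a *: q) = a * qx1 q.
Proof. by rewrite /qx1 mxE. Qed.
Lemma qx2Z (R : realType) (a : R) (q : quat R) : qx2 (a *: q) = a * qx2 q.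
Proof. by rewrite /qx2 mxE. Qed.
Lemma qx3Z (R : realType) (a : R) (q : quat R) : qx3 (a *: q) = a * qx3 q.
Proof. by rewrite /qx3 mxE. Qed.
Definition qxZ := (qx0Z, qx1Z, qx2Z, qx3Z).

Lemma qmulA (R : realType) : associative (@qmul R).
Proof. by move=> p q r; apply: quatP; rewrite !qx_mk; ring. Qed.

Lemma qmul1q (R : realType) : left_id (@qone R) (@qmul R).
Proof. by move=> q; apply: quatP; rewrite !qx_mk; ring. Qed.

Lemma qmulq1 (R : realType) : right_id (@qone R) (@qmul R).
Proof. by move=> q; apply: quatP; rewrite !qx_mk; ring. Qed.

Lemma qmulDl (R : realType) : left_distributive (@qmul R) +%R.
Proof. by move=> p q r; apply: quatP; rewrite !(qx_mk, qxD); ring. Qed.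

Lemma qmulDr (R : realType) : right_distributive (@qmul R) +%R.
Proof. by move=> p q r; apply: quatP; rewrite !(qx_mk, qxD); ring. Qed.

Lemma qone_neq0 (R : realType) : @qone R != 0.
Proof.
apply/eqP => /(congr1 (@qx0 R)); rewrite qx0_mk /qx0 mxE.
by move/eqP; rewrite oner_eq0.
Qed.

HB.instance Definition _ (R : realType) :=
  GRing.Zmodule_isNzRing.Build (quat R) (@qmulA R) (@qmul1q R) (@qmulq1 R)
    (@qmulDl R) (@qmulDr R) (@qone_neq0 R).

Lemma qscaleAl (R : realType) (a : R) (p q : quat R) :
  a *: (p * q) = (a *: p) * q.
Proof. by apply: quatP; rewrite !(qx_mk, qxZ); ring. Qed.

Lemma qscaleAr (R : realType) (a : R) (p q : quat R) :
  a *: (p * q) = p * (a *: q).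
Proof. by apply: quatP; rewrite !(qx_mk, qxZ); ring. Qed.

HB.instance Definition _ (R : realType) :=
  GRing.Lmodule_isLalgebra.Build R (quat R) (@qscaleAl R).
HB.instance Definition _ (R : realType) :=
  GRing.Lalgebra_isAlgebra.Build R (quat R) (@qscaleAr R).

Definition fueter_op (R : realType) (f : quat R -> quat R) (q : quat R) :
    quat R :=
  'D_(1 : quat R) f q + qi R * 'D_(qi R) f q + qj R * 'D_(qj R) f q
  + qk R * 'D_(qk R) f q.

Definition fueter_regular (R : realType) (U : set (quat R))
    (f : quat R -> quat R) : Prop :=
  open U /\ forall q, U q -> differentiable f q /\ fueter_op f q = 0.

(* Only the values of phi on the hyperplane x0 = 0 matter. *)
Definition is_ck_extension (R : realType) (phi F : quat R -> quat R) : Prop :=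
  fueter_regular setT F /\ forall q, qx0 q = 0 -> F q = phi q.

(* The unique global C-K extension (0 by default if there is no such unique
   function). *)
Definition ck_extension (R : realType) (phi : quat R -> quat R) :
    quat R -> quat R :=
  xget (fun=> 0) [set F | unique (is_ck_extension phi) F].

Definition ck_product (R : realType) (f g : quat R -> quat R) :
    quat R -> quat R :=
  ck_extension (fun q => f q * g q).

Definition coefT (R : realType) (k j : nat) : R :=
  (2 * (k - j + 1))%N%:R / ((k + 1) * (k + 2))%N%:R.

Definition polyQ (R : realType) (k : nat) (q : quat R) : quat R :=
  \sum_(j < k.+1) coefT R k j *: (q ^+ (k - j) * qconj q ^+ j).

Definition coefc (R : realType) (l : nat) : R :=
  \sum_(j < l.+1) (-1) ^+ j * coefT R l j.

(* Main.v *)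
Require Import Defs.
From HB Require Import structures.
From mathcomp Require Import all_boot all_order all_algebra.
From mathcomp Require Import all_classical all_reals all_analysis.
From mathcomp Require Import ring lra.
Set Implicit Arguments.
Unset Strict Implicit.
Unset Printing Implicit Defensive.
Import Order.TTheory GRing.Theory Num.Theory.
Import numFieldNormedType.Exports.
Local Open Scope classical_set_scope.
Local Open Scope ring_scope.

(** On the hyperplane x0 = 0 one has conj q = - q, so Q_k restricts there to
    c_k q^k. Hence the product of the restrictions of Q_k and Q_s is
    c_k c_s q^(k+s), which is also the restriction of the Fueter regular
    function (c_k c_s / c_(k+s)) Q_(k+s). The formula therefore follows from
    three facts: Q_k is Fueter regular ([polyQ_regular]), c_l is nonzero
    ([coefc_gt0]) and a C-K extension is unique ([ck_extension_unique]).

    Regularity of Q_k. With r = 2 x0 and n = |q|^2 one has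
    (1 - q z)(1 - conj q z) = 1 - r z + n z^2, and (k+1)(k+2)/2 Q_k is the
    coefficient of z^k in
      (1 - q z)^-2 (1 - conj q z)^-1 = (1 - conj q z) (1 - r z + n z^2)^-2.
    Up to scaling, the right-hand side is the Fueter-Cauchy kernel with its pole
    at the real point 1/z, which is regular in q. In terms of coefficients, Q_k
    is a multiple of U_k - U_(k-1) conj q with real-valued U_k ([fpoly]), and the
    operator is computed by means of linear recurrences.

    Uniqueness. A regular function is here only assumed differentiable at every
    point, so neither smoothness nor a power series is available. Let F be
    regular and zero on x0 = 0.
    - The tangential derivatives of F vanish on x0 = 0, and the equation then
      kills the normal one: dF = 0 there. So F stays regular when it is replaced
      by 0 on x0 <= 0 ([zero_ext_regular]).
    - The Kelvin transform, an inversion centred at the point -1, preserves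
      regularity ([kelvin_fueter]) and maps the half-space x0 > 0 to a ball
      tangent to the hyperplane t = 0 at the origin. The transformed function G
      is regular for t > 0, has compactly supported slices G(t, .) and vanishes
      for t >= 1.
    - For a polynomial p in the three imaginary coordinates, the equation and an
      integration by parts express the t-derivative of the integral of p G(t, .)
      by integrals of the same kind with polynomials of lower degree. By
      induction on the degree all these moments vanish ([moment_eq0]), hence
      G = 0 ([slab_uniqueness]).
    - The integration by parts is the divergence theorem for a vector field that
      is merely differentiable, but with continuous divergence
      ([divergence_box]). It is proved by the subdivision argument of Goursat. *)

(** * Integrals of continuous functions on intervals *)

Section RealContinuity.
Variables (R : realType) (T : topologicalType).
Implicit Types f g : T -> R.

Lemma cont_cst (k : R) : continuous (fun _ : T => k).
Proof. by move=> x; apply: cvg_cst. Qed.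

Lemma contD f g : continuous f -> continuous g -> continuous (fun x => f x + g x).
Proof. by move=> cf cg x; exact: (cvgD (@cf x) (@cg x)). Qed.

Lemma contB f g : continuous f -> continuous g -> continuous (fun x => f x - g x).
Proof. by move=> cf cg x; exact: (cvgB (@cf x) (@cg x)). Qed.

Lemma contM f g : continuous f -> continuous g -> continuous (fun x => f x * g x).
Proof. by move=> cf cg x; exact: (cvgM (@cf x) (@cg x)). Qed.

Lemma contX f k : continuous f -> continuous (fun x => f x ^+ k).
Proof.
move=> cf; elim: k => [|k IH].
  by rewrite (_ : (fun x => _) = (fun=> 1)) //; exact: cont_cst.
rewrite (_ : (fun x => _) = (fun x => f x * f x ^+ k)); first exact: contM.
by apply/funext => x; rewrite exprS.
Qed.

End RealContinuity.

Definition pint (R : realType) (f : R -> R) (a b : R) : R :=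
  \int[lebesgue_measure]_(u in `[a, b]) f u.

Section IntervalIntegral.
Variable R : realType.
Implicit Types (f g : R -> R) (a b c : R).

Lemma integrable_itv f a b : continuous f ->
  (@lebesgue_measure R).-integrable `[a, b] (EFin \o f).
Proof.
move=> cf; apply: continuous_compact_integrable; first exact: segment_compact.
exact: continuous_subspaceT.
Qed.

Lemma eq_pint f g a b : {in `[a, b], f =1 g} -> pint f a b = pint g a b.
Proof. by move=> fg; apply: eq_Rintegral => x; rewrite inE => /fg. Qed.

Lemma pintD f g a b : continuous f -> continuous g ->
  pint (fun u => f u + g u) a b = pint f a b + pint g a b.
Proof. by move=> cf cg; apply: RintegralD => //; exact: integrable_itv. Qed.

Lemma pintB f g a b : continuous f -> continuous g ->
  pint (fun u => f u - g u) a b = pint f a b - pint g a b.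
Proof. by move=> cf cg; apply: RintegralB => //; exact: integrable_itv. Qed.

Lemma pintZ k f a b : continuous f ->
  pint (fun u => k * f u) a b = k * pint f a b.
Proof. by move=> cf; apply: RintegralZl => //; exact: integrable_itv. Qed.

Lemma pint_cst k a b : a <= b -> pint (fun=> k) a b = k * (b - a).
Proof.
move=> ab; rewrite /pint Rintegral_cst//; congr (_ * _).
apply: (etrans (congr1 fine (lebesgue_measure_itv `[a, b]))) => /=.
by rewrite lte_fin; case: ltgtP ab => // -> _; rewrite subrr.
Qed.

Lemma le_pint f g a b : continuous f -> continuous g ->
  {in `[a, b], forall u, f u <= g u} -> pint f a b <= pint g a b.
Proof.
by move=> cf cg fg; apply: le_Rintegral => //; exact: integrable_itv.
Qed.

Lemma pint_bound f a b (M : R) : continuous f -> a <= b ->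
  {in `[a, b], forall u, `|f u| <= M} -> `|pint f a b| <= M * (b - a).
Proof.
move=> cf ab fM; rewrite -pint_cst//.
have cM : continuous (fun _ : R => M) by apply: cst_continuous.
apply: (@le_trans _ _ (pint (fun u => `|f u|) a b)).
  by apply: le_normr_Rintegral => //; exact: integrable_itv.
apply: (@le_pint (fun u => `|f u|)) => // u.
by apply: (cvg_comp _ _ (cf u)); exact: norm_continuous.
Qed.

Lemma pint_chasles f a b c : continuous f -> a <= c -> c <= b ->
  pint f a b = pint f a c + pint f c b.
Proof.
move=> cf ac cb.
apply/eqP; rewrite addrC -subr_eq; apply/eqP.
have := Rintegral_itvB (integrable_itv a b cf) (x := c).
rewrite !bnd_simp => /(_ ac cb) H; apply: (etrans H).
apply: Rintegral_itv_obnd_cbnd.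
apply: integrableS (integrable_itv c b cf) => //.
by apply: subset_itvr; rewrite bnd_simp.
Qed.

(** An integral over a compact interval depends continuously on a parameter
    because, by the tube lemma, a jointly continuous integrand varies uniformly
    over the interval. *)
Lemma pint_continuous (T : topologicalType) (f : T -> R -> R) a b : a <= b ->
  continuous (fun p : T * R => f p.1 p.2) ->
  continuous (fun t => pint (f t) a b).
Proof.
move=> ab cf t.
have cfs s : continuous (f s).
  move=> u; have := cf (s, u); apply: (@cvg_comp _ _ _ (fun v => (s, v))) => //=.
  move=> A [[P Q] /= [Ps Qu] PQ]; apply: filterS Qu => v Qv; apply: PQ => /=.
  by split => //; exact: nbhs_singleton Ps.
apply/cvgrPdist_le => e e0.
have d0 : 0 < b - a + 1 by rewrite ltr_wpDl// subr_ge0.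
have e'0 : 0 < e / (b - a + 1) by rewrite divr_gt0.
have : \forall s \near t, `[a, b] `<=`
    (fun u => `|f t u - f s u| <= e / (b - a + 1)).
  apply: (proj1 (compact_near_coveringP _) (@segment_compact R a b) T (nbhs t)
    (fun s u => `|f t u - f s u| <= e / (b - a + 1))).
  move=> u _.
  have /cvgrPdist_le /(_ _ (divr_gt0 e'0 (@ltr0n R 2))) /= [[A B]/= [At Bu] AB] :=
    cf (t, u).
  exists (B, A) => //= -[u' s] /= [Bu' As].
  have h1 := AB (t, u') (conj (nbhs_singleton At) Bu').
  have h2 := AB (s, u') (conj As Bu').
  move: h1 h2 => /= h1 h2.
  rewrite -(subrKA (f t u)) [X in X + _]addrC.
  rewrite (le_trans (ler_normD _ _))// [leRHS]splitr lerD//.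
  by rewrite addrC distrC.
apply: filterS => s fs /=.
rewrite -pintB//.
apply: le_trans (pint_bound (M := e / (b - a + 1)) _ ab _) _.
- by move=> u; apply: cvgB; exact: cfs.
- by move=> u uab; apply: fs.
rewrite mulrAC ler_pdivrMr// ler_pM2l// lerDl; exact: ler01.
Qed.

End IntervalIntegral.

(** * Iterated integrals over boxes *)

Section BoxIntegral.
Variables (R : realType) (n : nat).
Implicit Types (f g : 'rV[R]_n -> R) (a b x : 'rV[R]_n) (l m : 'I_n).
Implicit Types s : seq 'I_n.

Definition upd l (u : R) x : 'rV[R]_n := x + (u - x 0 l) *: delta_mx 0 l.

Lemma updE l u x i : upd l u x 0 i = if i == l then u else x 0 i.
Proof.
rewrite !mxE eqxx /=; case: eqP => [->|_]; rewrite ?mulr1 ?mulr0 ?addr0//.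
by rewrite addrC subrK.
Qed.

Lemma updC l m u v x : l != m -> upd l u (upd m v x) = upd m v (upd l u x).
Proof.
move=> lm; apply/rowP => i; rewrite !updE; case: (eqVneq i l) => // ->.
by rewrite (negbTE lm).
Qed.

Lemma upd_continuous l : continuous (fun p : 'rV[R]_n * R => upd l p.2 p.1).
Proof.
move=> p; apply: cvgD; first exact: cvg_fst.
apply: cvgZl; apply: cvgB; first exact: cvg_snd.
apply: (@cvg_comp _ _ _ (fun q : 'rV[R]_n * R => q.1) (fun y : 'rV[R]_n => y 0 l)).
  exact: cvg_fst.
exact: coord_continuous.
Qed.

Lemma upd_continuousl l u : continuous (upd l u).
Proof.
move=> x; have := @upd_continuous l (x, u).
apply: (@cvg_comp _ _ _ (fun y => (y, u))).
move=> A [[P Q] /= [Px Qu] PQ]; apply: filterS Px => y Py; apply: PQ => /=.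
by split => //; exact: nbhs_singleton Qu.
Qed.

Lemma upd_continuousr l x : continuous (upd l ^~ x).
Proof.
move=> u; have := @upd_continuous l (x, u).
apply: (@cvg_comp _ _ _ (fun v => (x, v))).
move=> A [[P Q] /= [Px Qu] PQ]; apply: filterS Qu => y Qy; apply: PQ => /=.
by split => //; exact: nbhs_singleton Px.
Qed.

Definition jint l a b f x : R := pint (fun u => f (upd l u x)) (a 0 l) (b 0 l).

(** Coordinates outside [s] are left as parameters, so that the same operator
    serves for volumes, for faces and for slices of a box. *)
Definition jbox s a b f : 'rV[R]_n -> R := foldr (fun l => jint l a b) f s.

Definition face l a b f x : R := f (upd l (b 0 l) x) - f (upd l (a 0 l) x).

Definition lebox a b := forall i, a 0 i <= b 0 i.

Lemma comp_updr f l x : continuous f -> continuous (fun u => f (upd l u x)).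
Proof.
by move=> cf u; apply: (cvg_comp _ _ (@upd_continuousr l x u)); exact: cf.
Qed.

Lemma comp_updl f l u : continuous f -> continuous (fun x => f (upd l u x)).
Proof.
by move=> cf x; apply: (cvg_comp _ _ (@upd_continuousl l u x)); exact: cf.
Qed.

Lemma face_continuous l a b f : continuous f -> continuous (face l a b f).
Proof.
by move=> cf x; exact: (cvgB (comp_updl cf (x:=x)) (comp_updl cf (x:=x))).
Qed.

Lemma jint_continuous l a b f : lebox a b -> continuous f ->
  continuous (jint l a b f).
Proof.
move=> ab cf; apply: pint_continuous => // p.
by apply: (cvg_comp _ _ (@upd_continuous l p)); exact: cf.
Qed.

Lemma jbox_continuous s a b f : lebox a b -> continuous f ->
  continuous (jbox s a b f).
Proof. by move=> ab cf; elim: s => //= l s; exact: jint_continuous. Qed.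

Lemma jboxD s a b f g : lebox a b -> continuous f -> continuous g ->
  jbox s a b (fun y => f y + g y) = (fun y => jbox s a b f y + jbox s a b g y).
Proof.
move=> ab cf cg; elim: s => //= l s ->; apply/funext => x.
by rewrite /jint pintD//; apply: comp_updr; exact: jbox_continuous.
Qed.

Lemma jboxB s a b f g : lebox a b -> continuous f -> continuous g ->
  jbox s a b (fun y => f y - g y) = (fun y => jbox s a b f y - jbox s a b g y).
Proof.
move=> ab cf cg; elim: s => //= l s ->; apply/funext => x.
by rewrite /jint pintB//; apply: comp_updr; exact: jbox_continuous.
Qed.

Lemma jbox_cst s a b k : lebox a b ->
  jbox s a b (fun=> k) = (fun=> k * \prod_(l <- s) (b 0 l - a 0 l)).
Proof.
move=> ab; elim: s => [|l s /= ->]; first by rewrite big_nil mulr1.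
apply/funext => x; rewrite /jint pint_cst// big_cons.
by rewrite -mulrA [X in _ * X]mulrC.
Qed.

Lemma jbox_bound s a b f (M D : R) x : lebox a b -> continuous f ->
  (forall i, b 0 i - a 0 i <= D) -> 0 <= M ->
  (forall y : 'rV[R]_n, (forall i, i \in s -> a 0 i <= y 0 i <= b 0 i) ->
    (forall i, i \notin s -> y 0 i = x 0 i) -> `|f y| <= M) ->
  `|jbox s a b f x| <= D ^+ size s * M.
Proof.
move=> ab cf bD M0; elim: s x => [|l s IHs] x fM /=.
  by rewrite expr0 mul1r; apply: fM.
have D0 : 0 <= D by apply: le_trans (bD l); rewrite subr_ge0.
apply: le_trans (@pint_bound _ _ _ _ (D ^+ size s * M) _ (ab l) _) _.
- by apply: comp_updr; exact: jbox_continuous.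
- move=> u; rewrite in_itv/= => uab; apply: IHs => y ys yx.
  apply: fM => i; rewrite inE.
    case: (boolP (i \in s)) => [/ys//|/yx ->]; rewrite orbF => /eqP ->.
    by rewrite updE eqxx.
  by rewrite negb_or => /andP[il /yx ->]; rewrite updE (negbTE il).
- by rewrite mulrC exprS -mulrA ler_wpM2r// mulr_ge0// exprn_ge0.
Qed.

Lemma jbox_eq_box s a b a' b' f :
  (forall i, i \in s -> a 0 i = a' 0 i /\ b 0 i = b' 0 i) ->
  jbox s a b f = jbox s a' b' f.
Proof.
elim: s => [//|l s IHs ss].
have [al bl] := ss l (mem_head _ _).
have E : jbox s a b f = jbox s a' b' f.
  by apply: IHs => i si; apply: ss; rewrite inE si orbT.
by rewrite /= /jint E al bl.
Qed.

Lemma lebox_updl m c a b : lebox a b -> c <= b 0 m -> lebox (upd m c a) b.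
Proof. by move=> ab cb i; rewrite updE; case: eqP => [->|]. Qed.

Lemma lebox_updr m c a b : lebox a b -> a 0 m <= c -> lebox a (upd m c b).
Proof. by move=> ab cb i; rewrite updE; case: eqP => [->|]. Qed.

(** The Chasles relation of the integral in coordinate [m] passes through the
    outer integrals by linearity. *)
Lemma jbox_split s a b f m c : lebox a b -> continuous f ->
  a 0 m <= c <= b 0 m -> uniq s -> m \in s ->
  jbox s a b f = (fun x => jbox s a (upd m c b) f x + jbox s (upd m c a) b f x).
Proof.
move=> ab cf /andP[ac cb].
have abl := lebox_updl ab cb; have abr := lebox_updr ab ac.
elim: s => //= l s IHs /andP[ls us]; rewrite inE; have [lm|ml] := eqVneq m l.
  move: ls; rewrite -lm => ls _; apply/funext => x; rewrite /jint !updE !eqxx.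
  rewrite (pint_chasles _ ac cb); last first.
    by apply: comp_updr; exact: jbox_continuous.
  have E i : i \in s -> (i == m) = false.
    by move=> si; apply: contraNF ls => /eqP <-.
  have El : jbox s a (upd m c b) f = jbox s a b f.
    by apply: jbox_eq_box => i si; rewrite updE E.
  have Er : jbox s (upd m c a) b f = jbox s a b f.
    by apply: jbox_eq_box => i si; rewrite updE E.
  by rewrite El Er.
move=> /= /IHs -> //; apply/funext => x; rewrite /jint !updE.
rewrite eq_sym (negbTE ml).
by rewrite pintD//; apply: comp_updr; exact: jbox_continuous.
Qed.

Lemma jbox_indep s a b f x (y : 'rV[R]_n) :
  (forall i, i \notin s -> x 0 i = y 0 i) -> jbox s a b f x = jbox s a b f y.
Proof.
elim: s x y => [|l s IHs] x y xy /=.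
  by congr f; apply/rowP => i; apply: xy.
apply: eq_pint => u _; apply: IHs => i si; rewrite !updE.
by case: eqVneq => // il; apply: xy; rewrite inE (negbTE il).
Qed.

Lemma jbox_upd s a b f l u x : l \notin s ->
  jbox s a b (fun y => f (upd l u y)) x = jbox s a b f (upd l u x).
Proof.
elim: s x => [//|m s IHs] x; rewrite inE negb_or => /andP[lm ls] /=.
by apply: eq_pint => v _; rewrite IHs// updC.
Qed.

Lemma jbox_eq0 s a b f x :
  (forall y : 'rV[R]_n, (forall i, i \notin s -> y 0 i = x 0 i) -> f y = 0) ->
  jbox s a b f x = 0.
Proof.
elim: s x => [|l s IHs] x fx /=; first exact: fx.
rewrite /jint (_ : (fun u => _) = fun=> 0).
  by rewrite /pint /Rintegral integral0.
apply/funext => u; apply: IHs => y yx; apply: fx => i.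
by rewrite inE negb_or => /andP[il /yx ->]; rewrite updE (negbTE il).
Qed.

Lemma jbox_sum s a b k (f : 'I_k -> 'rV[R]_n -> R) x :
  lebox a b -> (forall i, continuous (f i)) ->
  jbox s a b (fun y => \sum_(i < k) f i y) x = \sum_(i < k) jbox s a b (f i) x.
Proof.
move=> ab; elim: k f => [|k IH] f cf.
  rewrite big_ord0 (_ : (fun y => _) = fun=> 0) ?jbox_cst ?mul0r//.
  by apply/funext => y; rewrite big_ord0.
have cs j (g : 'I_j -> 'rV[R]_n -> R) : (forall i, continuous (g i)) ->
    continuous (fun y : 'rV[R]_n => \sum_(i < j) g i y).
  elim: j g => [|j IHj] g cg.
    rewrite (_ : (fun y => _) = fun=> 0); first exact: cont_cst.
    by apply/funext => y; rewrite big_ord0.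
  rewrite (_ : (fun y => _) = fun y => g ord0 y + \sum_(i < j) g (lift ord0 i) y).
    by apply: contD => //; apply: IHj.
  by apply/funext => y; rewrite big_ord_recl.
rewrite big_ord_recl -IH// (_ : (fun y => _) =
    fun y => f ord0 y + \sum_(i < k) f (lift ord0 i) y).
  by rewrite jboxD//; exact: cs.
by apply/funext => y; rewrite big_ord_recl.
Qed.

Definition others l : seq 'I_n := [seq m <- enum 'I_n | m != l].

Lemma mem_others l m : (m \in others l) = (m != l).
Proof. by rewrite mem_filter mem_enum andbT. Qed.

Lemma others_uniq l : uniq (others l).
Proof. by rewrite filter_uniq// enum_uniq. Qed.

Lemma size_others l : size (others l) = n.-1.
Proof.
rewrite size_filter -[in RHS](size_enum_ord n) -(count_predC (pred1 l)).
by rewrite (count_uniq_mem _ (enum_uniq _)) mem_enum.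
Qed.

(** The net flow through the two faces orthogonal to direction [l]. It does not
    depend on the point of evaluation, which is set to 0. *)
Definition flux l a b f : R := jbox (others l) a b (face l a b f) 0.

Definition vol a b f : R := jbox (enum 'I_n) a b f 0.

End BoxIntegral.

(** * The divergence theorem for differentiable fields *)

(** The first-order expansion in the epsilon form used by the subdivision
    argument; [diff_charac] below is its converse. *)
Lemma diff_estimate (R : realType) (U W : normedModType R) (f : U -> W) p (e : R) :
  differentiable f p -> 0 < e ->
  \forall x \near p, `|f x - f p - 'd f p (x - p)| <= e * `|x - p|.
Proof.
move=> df e0; have /eqaddoP /(_ e e0) := diff_locally df.
rewrite (near_shift 0 p) subr0 /=; apply: filterS => x /=.
by rewrite !fctE /= addrK opprD addrA.
Qed.

Section Divergence.
Variables (R : realType) (n : nat) (V : 'I_n -> 'rV[R]_n -> R).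
Variable K : 'rV[R]_n -> R.
Hypothesis dV : forall l x, differentiable (V l) x.
Hypothesis cK : continuous K.
Hypothesis divV : forall x, \sum_(l < n) 'd (V l) x (delta_mx 0 l) = K x.

Let cV l : continuous (V l).
Proof. by move=> x; exact: differentiable_continuous. Qed.

Let defect a b := \sum_(l < n) flux l a b (V l) - vol a b K.

(** Both terms of the defect are additive under a cut of the box in two: the
    fluxes through the new common face cancel. *)
Lemma defect_split m (c : R) a b : lebox a b -> a 0 m <= c <= b 0 m ->
  defect a b = defect a (upd m c b) + defect (upd m c a) b.
Proof.
move=> ab acb; have /andP[ac cb] := acb.
have abl := lebox_updl ab cb; have abr := lebox_updr ab ac.
rewrite /defect addrACA -opprD -big_split /=; congr (_ - _); last first.
  by rewrite /vol (jbox_split ab cK acb) ?enum_uniq ?mem_enum.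
apply: eq_bigr => l _; rewrite /flux; have [lm|lm] := eqVneq m l.
  have oE (a' b' : 'rV[R]_n) : (forall i, i != l -> a 0 i = a' 0 i /\ b 0 i = b' 0 i) ->
      jbox (others l) a' b' = jbox (others l) a b.
    move=> E; apply/funext => f; apply/esym/jbox_eq_box => i.
    by rewrite mem_others => /E.
  rewrite !oE; try by move=> i il; rewrite !updE lm (negbTE il).
  have cf a' b' : continuous (face l a' b' (V l)) by exact: face_continuous.
  rewrite -[RHS](congr1 (fun h => h 0) (jboxD (others l) ab (cf _ _) (cf _ _))).
  congr (jbox _ _ _ _ _); apply/funext => y; rewrite /face !updE lm eqxx.
  by rewrite [RHS]addrC subrKA.
rewrite (jbox_split ab _ acb (others_uniq _)) ?mem_others//; last first.
  exact: face_continuous.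
have El : face l a (upd m c b) (V l) = face l a b (V l).
  by apply/funext => y; rewrite /face updE eq_sym (negbTE lm).
have Er : face l (upd m c a) b (V l) = face l a b (V l).
  by apply/funext => y; rewrite /face updE eq_sym (negbTE lm).
by rewrite El Er.
Qed.

(** Cutting successively in every direction of [s], one of the two halves always
    carries at least half of the defect. *)
Lemma defect_halve (s : seq 'I_n) a b : uniq s -> lebox a b ->
  exists a' b', [/\ lebox a' b', lebox a a', lebox b' b,
    forall i, b' 0 i - a' 0 i =
      (if i \in s then 2^-1 else 1) * (b 0 i - a 0 i) &
    `|defect a b| <= 2 ^+ size s * `|defect a' b'|].
Proof.
move=> + ab; elim: s => [_|l s IHs /= /andP[ls us]].
  by exists a, b; split => // [i|]; rewrite /= ?expr0 ?mul1r.
have [a' [b' [ab' aa' bb' E D]]] := IHs us.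
pose c := (a' 0 l + b' 0 l) / 2.
have acb : a' 0 l <= c <= b' 0 l.
  by have := ab' l; rewrite /c => h; apply/andP; split; lra.
have /andP[ac cb] := acb.
have abl := lebox_updl ab' cb; have abr := lebox_updr ab' ac.
have := defect_split ab' acb.
have [h|/ltW h] := lerP `|defect (upd l c a') b'| `|defect a' (upd l c b')| => Dab.
- exists a', (upd l c b'); split => // [i|i|].
  + by apply: le_trans (bb' i); rewrite updE; case: eqP => [->|].
  + rewrite updE inE; have [->|il] := eqVneq i l; last exact: E.
    rewrite /=; have := E l; rewrite (negbTE ls) /c; lra.
  + apply: le_trans D _; rewrite exprSr -mulrA ler_pM2l ?exprn_gt0//.
    by rewrite Dab (le_trans (ler_normD _ _))// mulr_natl mulr2n lerD2l.
- exists (upd l c a'), b'; split => // [i|i|].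
  + by apply: (le_trans (aa' i)); rewrite updE; case: eqP => [->|].
  + rewrite updE inE; have [->|il] := eqVneq i l; last exact: E.
    rewrite /=; have := E l; rewrite (negbTE ls) /c; lra.
  + apply: le_trans D _; rewrite exprSr -mulrA ler_pM2l ?exprn_gt0//.
    by rewrite Dab (le_trans (ler_normD _ _))// mulr_natl mulr2n lerD2r.
Qed.

(** The theorem is exact for affine fields: the flux through opposite faces is
    the slope times the volume. *)
Lemma flux_affine l p a b k : lebox a b ->
  flux l a b (fun x => k + 'd (V l) p (x - p)) =
  'd (V l) p 'e_l * \prod_(m < n) (b 0 m - a 0 m).
Proof.
move=> ab; rewrite /flux.
have -> : face l a b (fun x => k + 'd (V l) p (x - p)) =
    (fun=> (b 0 l - a 0 l) * 'd (V l) p 'e_l).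
  apply/funext => x; rewrite /face opprD addrACA subrr add0r -linearB /=.
  rewrite opprB addrA subrK /upd opprD addrACA subrr add0r -scalerBl.
  by rewrite opprB addrA subrK linearZ.
rewrite jbox_cst// /others big_filter big_enum_cond /= [in RHS](bigD1 l)//=.
by rewrite -mulrA mulrCA.
Qed.

(** At a point of differentiability the field is affine up to an error e |x - p|.
    Faces have measure of order D^(n-1) and the error on them is of order e D, so
    the defect of a small box around p is o(D^n). *)
Lemma defect_small (p : 'rV[R]_n) (e : R) : 0 < e ->
  exists2 d : R, 0 < d & forall (a b : 'rV[R]_n) (D : R),
    (forall i, a 0 i <= p 0 i <= b 0 i) ->
    (forall i, b 0 i - a 0 i <= D) -> 0 <= D -> D < d ->
    `|defect a b| <= e * D ^+ n.
Proof.
move=> e0; pose e' := e / (n.*2.+1)%:R.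
have e'0 : 0 < e' by rewrite divr_gt0.
have : \forall x \near p, `|K p - K x| <= e' /\
    forall l, `|V l x - V l p - 'd (V l) p (x - p)| <= e' * `|x - p|.
  have H : \forall x \near p,
      forall l, `|V l x - V l p - 'd (V l) p (x - p)| <= e' * `|x - p|.
    exact: (filter_forall _ (fun l => diff_estimate (@dV l p) e'0)).
  apply: filterI H; by move/cvgrPdist_le : (@cK p) => /(_ e' e'0).
move=> /nbhs_ballP [d /= d0 pd]; exists d => // a b D apb abD D0 Dd.
have ab : lebox a b.
  by move=> i; have /andP[h1 h2] := apb i; exact: le_trans h2.
have near_box (x : 'rV[R]_n) : (forall i, a 0 i <= x 0 i <= b 0 i) ->
    `|x - p| <= D.
  move=> axb; rewrite /Num.Def.normr/= mx_normrE; apply/bigmax_leP.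
  split=> // -[i j] _ /=; rewrite (ord1 i) !mxE; have := abD j.
  by have := apb j; have := axb j; rewrite ler_norml => *; lra.
have est (x : 'rV[R]_n) : (forall i, a 0 i <= x 0 i <= b 0 i) -> `|K p - K x| <= e' /\
    forall l, `|V l x - V l p - 'd (V l) p (x - p)| <= e' * D.
  move=> /near_box xD; have [|h1 h2] := pd x.
    by rewrite -ball_normE /= distrC; exact: le_lt_trans Dd.
  by split=> // l; apply: (le_trans (h2 l)); rewrite ler_pM2l.
pose aff l (x : 'rV[R]_n) := V l p + 'd (V l) p (x - p).
have caff l : continuous (aff l).
  apply: contD; first exact: cont_cst.
  have cd : continuous ('d (V l) p) := diff_continuous (@dV l p).
  have cs : continuous (fun x : 'rV[R]_n => x - p).
    by move=> x; exact: (cvgB cvg_id (cvg_cst p)).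
  move=> x; have := @cd (x - p); have := @cs x.
  exact: continuous_comp.
pose r l (x : 'rV[R]_n) := V l x - aff l x.
have cr l : continuous (r l) by apply: contB; [exact: cV|exact: caff].
pose k (x : 'rV[R]_n) := K x - K p.
have ck : continuous k by apply: contB cK _; exact: cont_cst.
have cKp : continuous (fun _ : 'rV[R]_n => K p) by apply: cont_cst.
have -> : defect a b = \sum_(l < n) flux l a b (r l) - vol a b k.
  have fl l : flux l a b (V l) = flux l a b (aff l) + flux l a b (r l).
    rewrite /flux.
    have -> : face l a b (V l) =
        fun x => face l a b (aff l) x + face l a b (r l) x.
      by apply/funext => x; rewrite /face /r; ring.
    by rewrite jboxD//; apply: face_continuous.
  rewrite /defect (eq_bigr _ (fun l _ => fl l)) big_split /=.
  rewrite (eq_bigr _ (fun l _ => flux_affine l p (V l p) ab)) -mulr_suml divV.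
  have -> : vol a b K = vol a b k + vol a b (fun=> K p).
    have {1}-> : K = fun x => k x + K p by apply/funext => x; rewrite /k subrK.
    by rewrite /vol jboxD.
  by rewrite [X in _ - (_ + X)]/vol jbox_cst// big_enum /=; ring.
have Dn (l : 'I_n) : D ^+ n.-1 * D = D ^+ n by rewrite -exprSr prednK// -(ltn_predK (ltn_ord l)).
have flr l : `|flux l a b (r l)| <= 2 * e' * D ^+ n.
  have -> : 2 * e' * D ^+ n = D ^+ size (others l) * (2 * (e' * D)).
    by rewrite size_others -(Dn l); ring.
  apply: jbox_bound => //; first exact: face_continuous.
  - by rewrite !mulr_ge0// ltW.
  - move=> y yab _; rewrite /face.
    have rD u : a 0 l <= u <= b 0 l -> `|r l (upd l u y)| <= e' * D.
      move=> uab; have [|_ /(_ l)] := est (upd l u y).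
        move=> i; rewrite updE; case: eqVneq => [->//|il].
        by apply: yab; rewrite mem_others.
      by rewrite /r /aff opprD addrA.
    rewrite (le_trans (ler_normB _ _))// mulr_natl mulr2n.
    by apply: lerD; apply: rD; rewrite lexx ?andbT; exact: ab.
have vk : `|vol a b k| <= D ^+ n * e'.
  rewrite -[in X in _ <= X](size_enum_ord n); apply: jbox_bound => //.
    exact: ltW.
  move=> y yab _; have [|h _] := est y; first by move=> i; rewrite yab ?mem_enum.
  by rewrite distrC.
rewrite (le_trans (ler_normB _ _))//.
have : `|\sum_(l < n) flux l a b (r l)| <= n%:R * (2 * e' * D ^+ n).
  rewrite (le_trans (ler_norm_sum _ _ _))//.
  rewrite (le_trans (ler_sum _ (fun l _ => flr l)))//.
  by rewrite sumr_const card_ord [leRHS]mulr_natl.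
move=> h; apply: le_trans (lerD h vk) _.
have -> : e = (n.*2.+1)%:R * e' by rewrite /e' mulrC divfK.
have -> : (n.*2.+1)%:R = n%:R * 2 + 1 :> R by rewrite -addn1 natrD -muln2 natrM.
suff -> : n%:R * (2 * e' * D ^+ n) + D ^+ n * e' = (n%:R * 2 + 1) * e' * D ^+ n.
  exact: lexx.
by ring.
Qed.

(** Repeated halving gives nested boxes of side 2^-k whose defect is at least
    2^(-n k) times the initial one; at their common point this contradicts
    [defect_small] unless the initial defect is 0. *)
Lemma defect_eq0 (a b : 'rV[R]_n) : lebox a b -> defect a b = 0.
Proof.
move=> ab.
pose good (p q : 'rV[R]_n * 'rV[R]_n) := lebox p.1 p.2 ->
  [/\ lebox q.1 q.2, lebox p.1 q.1, lebox q.2 p.2,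
    forall i, q.2 0 i - q.1 0 i = 2^-1 * (p.2 0 i - p.1 0 i) &
    `|defect p.1 p.2| <= 2 ^+ n * `|defect q.1 q.2|].
have /choice [next nextP] : forall p, exists q, good p q.
  move=> [a1 b1]; have [ab1|nab1] := pselect (lebox a1 b1); last first.
    by exists (a1, b1) => /nab1.
  have [a2 [b2 [h1 h2 h3 h4 h5]]] := defect_halve (enum_uniq 'I_n) ab1.
  exists (a2, b2) => _; split => //= [i|]; first by rewrite h4 mem_enum.
  by rewrite -[X in _ ^+ X](size_enum_ord n).
pose bx k := iter k next (a, b).
have bxP k : [/\ lebox (bx k).1 (bx k).2,
    forall i, (bx k).2 0 i - (bx k).1 0 i = 2^-1 ^+ k * (b 0 i - a 0 i) &
    `|defect a b| <= (2 ^+ n) ^+ k * `|defect (bx k).1 (bx k).2|].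
  elim: k => [|k [h1 h2 h3]]; first by split => //= [i|]; rewrite expr0 mul1r.
  have [g1 _ _ g4 g5] := nextP _ h1; split => //= [i|].
    by rewrite g4 h2 mulrA -exprS.
  apply: (le_trans h3); rewrite exprSr -mulrA ler_pM2l ?exprn_gt0//.
have nest k j : lebox (bx k).1 (bx (j + k)%N).1 /\ lebox (bx (j + k)%N).2 (bx k).2.
  elim: j => [|j [IH1 IH2]]; first by split=> i; exact: lexx.
  have [g1 _ _] := bxP (j + k)%N; have [_ g2 g3 _ _] := nextP _ g1.
  by split=> i; [exact: le_trans (IH1 i) (g2 i)|exact: le_trans (g3 i) (IH2 i)].
have cross k j i : (bx k).1 0 i <= (bx j).2 0 i.
  have [h1 _] := nest k j; have [_ h2] := nest j k.
  have [g _ _] := bxP (j + k)%N.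
  by apply: le_trans (h1 i) (le_trans (g i) _); rewrite addnC.
(* The common point of the nested boxes: suprema of the lower corners. *)
pose A i := range (fun k => (bx k).1 0 i).
pose p : 'rV[R]_n := \row_i sup (A i).
have supA i : has_sup (A i).
  split; first by exists ((bx 0%N).1 0 i), 0%N.
  by exists ((bx 0%N).2 0 i) => _ [k _ <-].
have pbx k i : (bx k).1 0 i <= p 0 i <= (bx k).2 0 i.
  rewrite mxE; apply/andP; split.
    by apply: sup_upper_bound => //; exists k.
  by apply: sup_le_ub; [exact: (supA i).1|move=> _ [j _ <-]].
pose D0 := `|b - a| + 1.
have D0p : 0 < D0 by rewrite ltr_wpDl.
have bD i : b 0 i - a 0 i <= D0.
  have : `|(b - a) 0 i| <= `|b - a|.
    rewrite [leRHS]/Num.Def.normr/= mx_normrE.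
    exact: (le_bigmax _ (fun ij : 'I_1 * 'I_n => `|(b - a) ij.1 ij.2|) (0, i)).
  by rewrite !mxE; have := ab i; rewrite -subr_ge0 => /ger0_norm ->; rewrite /D0; lra.
apply/eqP; rewrite -normr_le0; apply/ler_addgt0Pl => e e0; rewrite addr0.
have e'0 : 0 < e / D0 ^+ n by rewrite divr_gt0// exprn_gt0.
have [d d0 small] := defect_small p e'0.
have /cvgrPdist_lt /(_ d d0) [k _ /(_ k (leqnn k)) /= kd] :
    (fun k => 2^-1 ^+ k * D0) @ \oo --> (0 * D0).
  apply: cvgMl; apply: cvg_expr; rewrite ger0_norm; lra.
rewrite mul0r sub0r normrN ger0_norm in kd; last first.
  by rewrite mulr_ge0// ?exprn_ge0// ltW.
have [_ h2 h3] := bxP k; apply: (le_trans h3).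
have h : `|defect (bx k).1 (bx k).2| <= e / D0 ^+ n * (2^-1 ^+ k * D0) ^+ n.
  apply: small => //; last by rewrite mulr_ge0// ?exprn_ge0// ltW.
  by move=> i; rewrite h2 ler_pM2l// exprn_gt0// invr_gt0.
rewrite (le_trans (ler_wpM2l _ h)) ?exprn_ge0//.
have E : (2 ^+ n) ^+ k * (2^-1 ^+ k) ^+ n = 1 :> R.
  by rewrite exprAC -!exprMn mulfV ?pnatr_eq0// !expr1n.
have F : D0 ^+ n / D0 ^+ n = 1 by rewrite divff// gt_eqF// exprn_gt0.
suff -> : (2 ^+ n) ^+ k * (e / D0 ^+ n * (2^-1 ^+ k * D0) ^+ n) =
    (2 ^+ n) ^+ k * (2^-1 ^+ k) ^+ n * e * (D0 ^+ n / D0 ^+ n).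
  by rewrite E F mul1r mulr1.
by rewrite exprMn; ring.
Qed.

End Divergence.

(** The partial derivatives may fail to be integrable separately, so Fubini and
    the fundamental theorem of calculus do not apply; the local estimate
    [defect_small] replaces them. *)
Theorem divergence_box (R : realType) (n : nat) (V : 'I_n -> 'rV[R]_n -> R) K a b :
  (forall l x, differentiable (V l) x) -> continuous K ->
  (forall x, \sum_(l < n) 'd (V l) x 'e_l = K x) -> lebox a b ->
  \sum_(l < n) flux l a b (V l) = vol a b K.
Proof.
move=> dV cK divV ab; apply/eqP; rewrite -subr_eq0; apply/eqP.
exact: (defect_eq0 dV cK divV ab).
Qed.

(** * Continuous functions with vanishing moments *)

Section Moments.
Variable R : realType.

Lemma le_pint_cst (f : R -> R) a b (k : R) : a <= b -> continuous f ->
  {in `[a, b], forall u, k <= f u} -> k * (b - a) <= pint f a b.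
Proof.
move=> ab cf kf; rewrite -pint_cst//.
by apply: le_pint => //; exact: cont_cst.
Qed.

Lemma bernoulli_ineq (h : R) m : 0 <= h -> 1 + m%:R * h <= (1 + h) ^+ m.
Proof.
move=> h0; elim: m => [|m IH]; first by rewrite mul0r addr0 expr0.
rewrite exprS (le_trans _ (ler_wpM2l _ IH)) ?addr_ge0//.
rewrite -[m.+1]addn1 natrD.
have : 0 <= m%:R * h * h by rewrite !mulr_ge0.
by lra.
Qed.

(** The polynomials annihilated by integration against [u] form an ideal; powers
    of one quadratic polynomial are all that [moments_pos_absurd] requires. *)
Lemma quadratic_moments (u : R -> R) (p q r : R) a b : continuous u ->
  (forall n, pint (fun x => x ^+ n * u x) a b = 0) ->
  forall m n, pint (fun x => x ^+ n * ((p + q * x + r * x ^+ 2) ^+ m * u x)) a b = 0.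
Proof.
move=> cu mu.
have cid : continuous (fun x : R => x) by move=> x; exact: cvg_id.
elim=> [|m IH] n.
  rewrite -[RHS](mu n); apply: eq_pint => x _ /=.
  by rewrite expr0 mul1r.
pose w x := (p + q * x + r * x ^+ 2) ^+ m * u x.
have cw : continuous w.
  apply: contM => //; apply: contX; apply: contD; first apply: contD.
  - exact: cont_cst.
  - by apply: contM => //; exact: cont_cst.
  - by apply: contM; [exact: cont_cst|exact: contX].
have cxw k : continuous (fun x : R => x ^+ k * w x) by apply: contM => //; exact: contX.
have -> : (fun x => x ^+ n * ((p + q * x + r * x ^+ 2) ^+ m.+1 * u x)) =
   (fun x => p * (x ^+ n * w x) + q * (x ^+ n.+1 * w x) + r * (x ^+ n.+2 * w x)).
  by apply/funext => x; rewrite /w !exprS; ring.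
have cz (k : R) j : continuous (fun x : R => k * (x ^+ j * w x)).
  by apply: contM => //; exact: cont_cst.
rewrite pintD//; last exact: contD.
by rewrite pintD// !pintZ// !IH !mulr0 !addr0.
Qed.

(** Landau's argument. The powers of a quadratic polynomial that exceeds 1 near
    [x0], and has values in [0, 1] away from [x0], concentrate at [x0]: if u is
    positive there, then the integrals of p^m u grow exponentially. *)
Lemma moments_pos_absurd (u : R -> R) (x0 : R) : continuous u -> -1 <= x0 <= 1 ->
  0 < u x0 -> (forall n, pint (fun x => x ^+ n * u x) (-1) 1 = 0) -> False.
Proof.
move=> cu x01 ux0 mu.
have [d [d0 d1 ud]] : exists d : R, [/\ 0 < d, d <= 1 &
    forall x, `|x - x0| < d -> u x0 / 2 <= u x].
  have /cvgrPdist_le /(_ (u x0 / 2)) := @cu x0.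
  move=> /(_ (divr_gt0 ux0 (ltr0n _ 2))) /nbhs_ballP [d /= d0 H].
  exists (Num.min d 1); split; rewrite ?lt_min ?d0 ?ltr01 ?ge_min ?lexx ?orbT// => x.
  rewrite lt_min => /andP[xd _]; have := H x.
  rewrite -ball_normE /= distrC => /(_ xd).
  by rewrite ler_norml => /andP[_]; lra.
have [M [M0 uM]] : exists M : R, 0 <= M /\ {in `[-1, 1], forall x, `|u x| <= M}.
  have cn : continuous (fun x => `|u x|).
    by move=> x; apply: (cvg_comp _ _ (@cu x)); exact: norm_continuous.
  have l11 : -1 <= 1 :> R by lra.
  have cn' : {within `[(-1 : R), 1], continuous (fun x => `|u x|)}.
    exact: continuous_subspaceT.
  have [c _ H] := EVT_max l11 cn'.
  by exists `|u c|; split.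
(* On [-1, 1] one has (x - x0)^2 / 4 <= 1, hence p > 0. Moreover
   p <= 1 - d^2/8 if |x - x0| >= d and p >= 1 + d^2/16 if |x - x0| <= d/2. *)
pose p x : R := 1 + d ^+ 2 / 8 - (x - x0) ^+ 2 / 4.
have pE x : p x = (1 + d ^+ 2 / 8 - x0 ^+ 2 / 4) + (x0 / 2) * x + (- 4^-1) * x ^+ 2.
  by rewrite /p; field.
have mp m : pint (fun x => p x ^+ m * u x) (-1) 1 = 0.
  rewrite -[RHS](quadratic_moments (1 + d ^+ 2 / 8 - x0 ^+ 2 / 4) (x0 / 2) (- 4^-1) cu mu m 0).
  by apply: eq_pint => x _; rewrite /= -pE expr0 mul1r.
have cpu m : continuous (fun x => p x ^+ m * u x).
  apply: contM => //; apply: contX; apply: contB; first exact: cont_cst.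
  apply: contM; last exact: cont_cst.
  by apply: contX; apply: contB; [move=> x; exact: cvg_id|exact: cont_cst].
have d20 : 0 < d ^+ 2 by rewrite exprn_gt0.
(* At an end point of [-1, 1] only one side of x0 is available. *)
have [c1 [c2 [c11 c12 c21 cd cJ]]] : exists c1 c2 : R, [/\ -1 <= c1, c1 <= c2, c2 <= 1,
    c2 - c1 = d / 2 & forall x, c1 <= x <= c2 -> `|x - x0| <= d / 2].
  have [x00|x00] := lerP x0 0.
    by exists x0, (x0 + d / 2); split; [lra|lra|lra|lra|move=> x xc; rewrite ler_norml; lra].
  by exists (x0 - d / 2), x0; split; [lra|lra|lra|lra|move=> x xc; rewrite ler_norml; lra].
have lowJ m : (1 + d ^+ 2 / 16) ^+ m * (u x0 / 2) * (c2 - c1) <=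
    pint (fun x => p x ^+ m * u x) c1 c2.
  apply: le_pint_cst => // x; rewrite in_itv/= => /cJ xd.
  apply: ler_pM; [by rewrite exprn_ge0//; lra|lra| |by apply: ud; lra].
  have px : 1 + d ^+ 2 / 16 <= p x.
    have : (x - x0) ^+ 2 <= (d / 2) ^+ 2.
      by rewrite -(real_normK (num_real (x - x0))) lerXn2r ?nnegrE//; lra.
    by rewrite /p expr_div_n; lra.
  by apply: lerXn2r => //; rewrite nnegrE; lra.
have lowE m c c' : -1 <= c -> c <= c' -> c' <= 1 ->
    - M * (c' - c) <= pint (fun x => p x ^+ m * u x) c c'.
  move=> h1 h2 h3; apply: le_pint_cst => // x; rewrite in_itv/= => xc.
  have p0 : 0 <= p x.
    rewrite /p; have : (x - x0) ^+ 2 <= 2 ^+ 2.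
      by rewrite -(real_normK (num_real (x - x0))) lerXn2r ?nnegrE// ler_norml; lra.
    by lra.
  have [xd|xd] := ltP `|x - x0| d.
    by rewrite (@le_trans _ _ 0) ?oppr_le0// mulr_ge0 ?exprn_ge0//; have := ud x xd; lra.
  have p1 : p x <= 1.
    rewrite /p; have : d ^+ 2 <= (x - x0) ^+ 2.
      by rewrite -(real_normK (num_real (x - x0))) lerXn2r ?nnegrE// ltW.
    lra.
  have : `|p x ^+ m * u x| <= M.
    rewrite normrM ger0_norm ?exprn_ge0//.
    apply: le_trans (ler_piMl _ _) _ => //; first exact: exprn_ile1.
    by apply: uM; rewrite in_itv/=; lra.
  by rewrite ler_norml => /andP[].
pose N := Num.bound ((2 * M) / (d ^+ 2 / 16 * (u x0 / 2) * (d / 2))).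
have := mp N.
rewrite (pint_chasles (cpu N) c11 (le_trans c12 c21)) (pint_chasles (cpu N) c12 c21).
have := lowE N (-1) c1 (lexx _) c11 (le_trans c12 c21).
have := lowE N c2 1 (le_trans c11 c12) c21 (lexx _).
have := lowJ N; rewrite cd.
have k0 : 0 < d ^+ 2 / 16 * (u x0 / 2) * (d / 2) by rewrite !mulr_gt0; lra.
have : 2 * M < N%:R * (d ^+ 2 / 16 * (u x0 / 2) * (d / 2)).
  rewrite -ltr_pdivrMr//; apply: archi_boundP; rewrite divr_ge0//; last exact: ltW.
  by rewrite mulr_ge0.
have : (1 + N%:R * (d ^+ 2 / 16)) * (u x0 / 2 * (d / 2)) <= (1 + d ^+ 2 / 16) ^+ N * (u x0 / 2 * (d / 2)).
  rewrite ler_wpM2r ?mulr_ge0//; try lra.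
  by apply: bernoulli_ineq; lra.
have : 0 <= u x0 / 2 * (d / 2) by rewrite mulr_ge0//; lra.
have : M * (c2 - c1) >= 0 by rewrite mulr_ge0// cd; lra.
set X := (_ ^+ N); set A := pint _ _ _; set B := pint _ _ _; set C := pint _ _ _.
rewrite !mulrA => ? ? ? ? ? ? ? ?.
nra.
Qed.

Lemma moments_eq0 (u : R -> R) : continuous u ->
  (forall n, pint (fun x => x ^+ n * u x) (-1) 1 = 0) ->
  {in `[-1, 1], forall x, u x = 0}.
Proof.
move=> cu mu x; rewrite in_itv /= => x1.
have [ux|ux|//] := ltgtP (u x) 0; last first.
  by have := moments_pos_absurd cu x1 ux mu.
have cNu : continuous (fun y => - u y).
  by move=> y; exact: (cvgN (@cu y)).
have : 0 < - u x by rewrite oppr_gt0.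
move=> /(moments_pos_absurd cNu x1); case=> m.
rewrite (_ : (fun y => _) = fun y => -1 * (y ^+ m * u y)).
  rewrite pintZ ?mu ?mulr0//; apply: contM => //.
  by apply: contX => y; exact: cvg_id.
by apply/funext => y; rewrite mulN1r mulrN.
Qed.

End Moments.

Section BoxMoments.
Variables (R : realType) (n : nat) (a b : 'rV[R]_n).
Hypothesis ab : lebox a b.
Implicit Types (f g h : 'rV[R]_n -> R) (s : seq 'I_n) (x : 'rV[R]_n).

Lemma jbox_pull s h f x : continuous f ->
  (forall l u y, l \in s -> h (upd l u y) = h y) ->
  jbox s a b (fun y => h y * f y) x = h x * jbox s a b f x.
Proof.
move=> cf; elim: s x => [//|l s IHs] x hs /=.
rewrite /jint -pintZ; last by apply: comp_updr; exact: jbox_continuous.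
apply: eq_pint => u _; rewrite IHs; last first.
  by move=> m v y ms; apply: hs; rewrite inE ms orbT.
by rewrite hs ?mem_head.
Qed.

(** The one-dimensional case is applied to one coordinate after the other, to
    the moments in the remaining coordinates as functions of that coordinate. *)
Lemma jbox_moments s f x : uniq s -> continuous f ->
  (forall l, l \in s -> a 0 l = -1 /\ b 0 l = 1) ->
  (forall e : 'I_n -> nat,
    jbox s a b (fun y => (\prod_(l <- s) y 0 l ^+ e l) * f y) x = 0) ->
  (forall l, l \in s -> -1 <= x 0 l <= 1) -> f x = 0.
Proof.
move=> + cf; elim: s x => [|l s IHs] x.
  by move=> _ _ /(_ (fun=> 0%N)) /=; rewrite big_nil mul1r.
move=> /= /andP[ls us] abs mom xs.
have cp (s' : seq 'I_n) e : continuous (fun y : 'rV[R]_n => \prod_(l <- s') y 0 l ^+ e l).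
  elim: s' => [|m s' IH].
    rewrite (_ : (fun y => _) = fun=> 1); first exact: cont_cst.
    by apply/funext => y; rewrite big_nil.
  rewrite (_ : (fun y => _) = fun y : 'rV[R]_n => y 0 m ^+ e m * \prod_(l <- s') y 0 l ^+ e l).
    by apply: contM => //; apply: contX; exact: coord_continuous.
  by apply/funext => y; rewrite big_cons.
have cg (e : 'I_n -> nat) : continuous (fun y : 'rV[R]_n => (\prod_(l <- s) y 0 l ^+ e l) * f y).
  exact: contM.
apply: IHs => //.
- by move=> m ms; apply: abs; rewrite inE ms orbT.
- move=> e; pose g := jbox s a b (fun y => (\prod_(l <- s) y 0 l ^+ e l) * f y).
  have cG : continuous g by exact: jbox_continuous.
  have xE : upd l (x 0 l) x = x.
    by apply/rowP => i; rewrite updE; case: eqP => [->|].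
  rewrite -[LHS]/(g x) -xE.
  have xl : x 0 l \in `[-1, 1] by rewrite in_itv/=; apply: xs; rewrite mem_head.
  apply: (moments_eq0 (u := fun u => g (upd l u x)) _ _ xl); first exact: comp_updr.
  move=> k; have [al bl] := abs l (mem_head _ _).
  have := mom (fun m => if m == l then k else e m).
  rewrite /= /jint al bl => <-; apply: eq_pint => u _.
  have -> : (fun y : 'rV[R]_n => (\prod_(m <- l :: s) y 0 m ^+ (if m == l then k else e m)) * f y) =
      (fun y : 'rV[R]_n => y 0 l ^+ k * ((\prod_(l <- s) y 0 l ^+ e l) * f y)).
    apply/funext => y; rewrite big_cons eqxx -mulrA; congr (_ * (_ * _)).
    apply: eq_big_seq => m ms; case: eqP => // ml.
    by move: ls; rewrite -ml ms.
  rewrite (jbox_pull _ (cg e)) ?updE ?eqxx// => m v y ms.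
  by rewrite updE; case: eqP => // lm; move: ls; rewrite lm ms.
- by move=> m ms; apply: xs; rewrite inE ms orbT.
Qed.

End BoxMoments.

(** * Differential calculus of quaternion-valued functions *)

Section QuaternionCalculus.
Variable R : realType.
Implicit Types (U : normedModType R) (p q : quat R).

Lemma qx0M p q : qx0 (p * q) =
  qx0 p * qx0 q - qx1 p * qx1 q - qx2 p * qx2 q - qx3 p * qx3 q.
Proof. by rewrite qx0_mk. Qed.
Lemma qx1M p q : qx1 (p * q) =
  qx0 p * qx1 q + qx1 p * qx0 q + qx2 p * qx3 q - qx3 p * qx2 q.
Proof. by rewrite qx1_mk. Qed.
Lemma qx2M p q : qx2 (p * q) =
  qx0 p * qx2 q - qx1 p * qx3 q + qx2 p * qx0 q + qx3 p * qx1 q.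
Proof. by rewrite qx2_mk. Qed.
Lemma qx3M p q : qx3 (p * q) =
  qx0 p * qx3 q + qx1 p * qx2 q - qx2 p * qx1 q + qx3 p * qx0 q.
Proof. by rewrite qx3_mk. Qed.
Definition qxM := (qx0M, qx1M, qx2M, qx3M).

Lemma qx0N p : qx0 (- p) = - qx0 p. Proof. by rewrite /qx0 mxE. Qed.
Lemma qx1N p : qx1 (- p) = - qx1 p. Proof. by rewrite /qx1 mxE. Qed.
Lemma qx2N p : qx2 (- p) = - qx2 p. Proof. by rewrite /qx2 mxE. Qed.
Lemma qx3N p : qx3 (- p) = - qx3 p. Proof. by rewrite /qx3 mxE. Qed.
Definition qxN := (qx0N, qx1N, qx2N, qx3N).

Lemma qx00 : qx0 (0 : quat R) = 0. Proof. by rewrite /qx0 mxE. Qed.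
Lemma qx10 : qx1 (0 : quat R) = 0. Proof. by rewrite /qx1 mxE. Qed.
Lemma qx20 : qx2 (0 : quat R) = 0. Proof. by rewrite /qx2 mxE. Qed.
Lemma qx30 : qx3 (0 : quat R) = 0. Proof. by rewrite /qx3 mxE. Qed.
Definition qx_0 := (qx00, qx10, qx20, qx30).

Lemma qx01 : qx0 (1 : quat R) = 1. Proof. by rewrite [LHS]qx0_mk. Qed.
Lemma qx11 : qx1 (1 : quat R) = 0. Proof. by rewrite [LHS]qx1_mk. Qed.
Lemma qx21 : qx2 (1 : quat R) = 0. Proof. by rewrite [LHS]qx2_mk. Qed.
Lemma qx31 : qx3 (1 : quat R) = 0. Proof. by rewrite [LHS]qx3_mk. Qed.
Definition qx_1 := (qx01, qx11, qx21, qx31).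

Lemma qx_qi : [/\ qx0 (qi R) = 0, qx1 (qi R) = 1, qx2 (qi R) = 0 & qx3 (qi R) = 0].
Proof. by rewrite /qi !qx_mk. Qed.
Lemma qx_qj : [/\ qx0 (qj R) = 0, qx1 (qj R) = 0, qx2 (qj R) = 1 & qx3 (qj R) = 0].
Proof. by rewrite /qj !qx_mk. Qed.
Lemma qx_qk : [/\ qx0 (qk R) = 0, qx1 (qk R) = 0, qx2 (qk R) = 0 & qx3 (qk R) = 1].
Proof. by rewrite /qk !qx_mk. Qed.
Lemma qx_qconj q : [/\ qx0 (qconj q) = qx0 q, qx1 (qconj q) = - qx1 q,
  qx2 (qconj q) = - qx2 q & qx3 (qconj q) = - qx3 q].
Proof. by rewrite /qconj !qx_mk. Qed.

Definition qxE := (qxM, qxD, qxN, qxZ, qx_mk, qx_0, qx_1).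

Lemma quat_basis q :
  q = qx0 q *: 1 + qx1 q *: qi R + qx2 q *: qj R + qx3 q *: qk R.
Proof. by apply: quatP; rewrite !qxE; ring. Qed.

(** A directional derivative only sees the restriction of [f] to a line. *)
Lemma is_derive_along (U W : normedModType R) (f : U -> W) x v :
  (forall h, f (h *: v + x) = f x) -> is_derive x v f 0.
Proof.
move=> fx.
have E : (fun h : R => h^-1 *: ((f \o shift x) (h *: v) - f x)) = fun=> 0.
  by apply/funext => h /=; rewrite fx subrr scaler0.
have L : (fun h : R => h^-1 *: ((f \o shift x) (h *: v) - f x)) @ 0^' --> (0 : W).
  by rewrite E; exact: cvg_cst.
split; first by apply/cvg_ex; exists 0.
exact: cvg_lim L.
Qed.

Lemma ord4_ind (P : 'I_4 -> Prop) : P 0 -> P 1 -> P 2 -> P 3 -> forall i, P i.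
Proof.
move=> h0 h1 h2 h3; case=> -[|[|[|[|//]]]] hi.
- by rewrite (_ : Ordinal hi = 0) //; exact: val_inj.
- by rewrite (_ : Ordinal hi = 1) //; exact: val_inj.
- by rewrite (_ : Ordinal hi = 2) //; exact: val_inj.
- by rewrite (_ : Ordinal hi = 3) //; exact: val_inj.
Qed.

Lemma is_derive_quat U (f : U -> quat R) x v d0 d1 d2 d3 :
  is_derive x v (fun y => qx0 (f y)) d0 -> is_derive x v (fun y => qx1 (f y)) d1 ->
  is_derive x v (fun y => qx2 (f y)) d2 -> is_derive x v (fun y => qx3 (f y)) d3 ->
  is_derive x v f (mkquat d0 d1 d2 d3).
Proof.
move=> h0 h1 h2 h3.
have df : derivable f x v.
  apply/derivable_mxP => i; rewrite (ord1 i); elim/ord4_ind.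
  - exact: (@ex_derive _ _ _ _ _ _ _ h0).
  - exact: (@ex_derive _ _ _ _ _ _ _ h1).
  - exact: (@ex_derive _ _ _ _ _ _ _ h2).
  - exact: (@ex_derive _ _ _ _ _ _ _ h3).
split=> //; rewrite (derive_mx df); apply: quatP; rewrite qx_mk /qx0 /qx1 /qx2 /qx3 mxE.
- exact: (@derive_val _ _ _ _ _ _ _ h0).
- exact: (@derive_val _ _ _ _ _ _ _ h1).
- exact: (@derive_val _ _ _ _ _ _ _ h2).
- exact: (@derive_val _ _ _ _ _ _ _ h3).
Qed.

Lemma is_derive_coord U (f : U -> quat R) x v df i :
  is_derive x v f df -> is_derive x v (fun y => f y 0 i) (df 0 i).
Proof.
move=> [h1 h2]; have /derivable_mxP h := h1; split; first exact: h.
by rewrite -h2 (derive_mx h1) mxE.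
Qed.

Lemma is_derive_qmul U (f g : U -> quat R) x v df dg :
  is_derive x v f df -> is_derive x v g dg ->
  is_derive x v (fun y => f y * g y) (df * g x + f x * dg).
Proof.
move=> hf hg.
have F i := is_derive_coord i hf; have G i := is_derive_coord i hg.
have {F}[F0 F1 F2 F3] : [/\ is_derive x v (fun y => qx0 (f y)) (qx0 df),
  is_derive x v (fun y => qx1 (f y)) (qx1 df),
  is_derive x v (fun y => qx2 (f y)) (qx2 df) &
  is_derive x v (fun y => qx3 (f y)) (qx3 df)] by split; exact: F.
have {G}[G0 G1 G2 G3] : [/\ is_derive x v (fun y => qx0 (g y)) (qx0 dg),
  is_derive x v (fun y => qx1 (g y)) (qx1 dg),
  is_derive x v (fun y => qx2 (g y)) (qx2 dg) &
  is_derive x v (fun y => qx3 (g y)) (qx3 dg)] by split; exact: G.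
rewrite [X in is_derive _ _ _ X](_ : _ = mkquat (qx0 (df * g x + f x * dg))
  (qx1 (df * g x + f x * dg)) (qx2 (df * g x + f x * dg))
  (qx3 (df * g x + f x * dg))); last by apply: quatP; rewrite qx_mk.
apply: is_derive_quat.
- rewrite (_ : (fun y => _) = fun y => qx0 (f y) * qx0 (g y) - qx1 (f y) * qx1 (g y)
    - qx2 (f y) * qx2 (g y) - qx3 (f y) * qx3 (g y)); last first.
    by apply/funext => y; rewrite qxM.
  by apply: is_derive_eq; rewrite !qxE /GRing.scale /=; ring.
- rewrite (_ : (fun y => _) = fun y => qx0 (f y) * qx1 (g y) + qx1 (f y) * qx0 (g y)
    + qx2 (f y) * qx3 (g y) - qx3 (f y) * qx2 (g y)); last first.
    by apply/funext => y; rewrite qxM.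
  by apply: is_derive_eq; rewrite !qxE /GRing.scale /=; ring.
- rewrite (_ : (fun y => _) = fun y => qx0 (f y) * qx2 (g y) - qx1 (f y) * qx3 (g y)
    + qx2 (f y) * qx0 (g y) + qx3 (f y) * qx1 (g y)); last first.
    by apply/funext => y; rewrite qxM.
  by apply: is_derive_eq; rewrite !qxE /GRing.scale /=; ring.
- rewrite (_ : (fun y => _) = fun y => qx0 (f y) * qx3 (g y) + qx1 (f y) * qx2 (g y)
    - qx2 (f y) * qx1 (g y) + qx3 (f y) * qx0 (g y)); last first.
    by apply/funext => y; rewrite qxM.
  by apply: is_derive_eq; rewrite !qxE /GRing.scale /=; ring.
Qed.

Lemma differentiable_quat U (f : U -> quat R) x :
  (forall i, differentiable (fun y => f y 0 i) x) -> differentiable f x.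
Proof.
move=> df.
rewrite (_ : f = \sum_(i < 4) (fun y => f y 0 i *: ('e_i : 'rV[R]_4))).
  by apply: differentiable_sum => i; exact: differentiableZl.
apply/funext => y; rewrite fct_sumE; apply/rowP => j.
rewrite summxE (bigD1 j)//= !mxE !eqxx mulr1 big1 ?addr0// => i ij.
by rewrite !mxE eq_sym (negbTE ij) andbF mulr0.
Qed.

Lemma differentiable_qx U (f : U -> quat R) x i :
  differentiable f x -> differentiable (fun y => f y 0 i) x.
Proof.
move=> df; apply: (differentiable_comp (g := fun M : 'rV[R]_4 => M 0 i)) => //.
exact: differentiable_coord.
Qed.

Lemma differentiable_qmul U (f g : U -> quat R) x :
  differentiable f x -> differentiable g x -> differentiable (fun y => f y * g y) x.
Proof.
move=> hf hg.
have F i := differentiable_qx i hf; have G i := differentiable_qx i hg.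
have FG i j : differentiable (fun y => f y 0 i * g y 0 j) x.
  exact: differentiableM.
apply: differentiable_quat; elim/ord4_ind.
- rewrite (_ : (fun y => _) = (fun y => f y 0 0 * g y 0 0) - (fun y => f y 0 1 * g y 0 1)
    - (fun y => f y 0 2 * g y 0 2) - (fun y => f y 0 3 * g y 0 3)); last first.
    by apply/funext => y; exact: qx0M.
  by do ![apply: differentiableB|apply: differentiableD].
- rewrite (_ : (fun y => _) = (fun y => f y 0 0 * g y 0 1) + (fun y => f y 0 1 * g y 0 0)
    + (fun y => f y 0 2 * g y 0 3) - (fun y => f y 0 3 * g y 0 2)); last first.
    by apply/funext => y; exact: qx1M.
  by do ![apply: differentiableB|apply: differentiableD].
- rewrite (_ : (fun y => _) = (fun y => f y 0 0 * g y 0 2) - (fun y => f y 0 1 * g y 0 3)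
    + (fun y => f y 0 2 * g y 0 0) + (fun y => f y 0 3 * g y 0 1)); last first.
    by apply/funext => y; exact: qx2M.
  by do ![apply: differentiableB|apply: differentiableD].
- rewrite (_ : (fun y => _) = (fun y => f y 0 0 * g y 0 3) + (fun y => f y 0 1 * g y 0 2)
    - (fun y => f y 0 2 * g y 0 1) + (fun y => f y 0 3 * g y 0 0)); last first.
    by apply/funext => y; exact: qx3M.
  by do ![apply: differentiableB|apply: differentiableD].
Qed.

Lemma diff_partials (F : quat R -> quat R) w v : differentiable F w ->
  'd F w v = qx0 v *: 'D_(1 : quat R) F w + qx1 v *: 'D_(qi R) F w +
    qx2 v *: 'D_(qj R) F w + qx3 v *: 'D_(qk R) F w.
Proof.
by move=> dF; rewrite !deriveE// -!linearZ -!linearD /= -quat_basis.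
Qed.

Lemma is_derive_comp U (F : quat R -> quat R) (phi : U -> quat R) y v dphi :
  differentiable F (phi y) -> differentiable phi y -> is_derive y v phi dphi ->
  is_derive y v (fun z => F (phi z)) ('d F (phi y) dphi).
Proof.
move=> dF dp [_ <-]; have dFp : differentiable (F \o phi) y.
  exact: differentiable_comp.
split; first exact: diff_derivable.
by rewrite -[LHS]/('D_v (F \o phi) y) deriveE// diff_comp// deriveE.
Qed.

End QuaternionCalculus.

(** * The Kelvin transform *)

Section Inversion.
Variable R : realType.
Implicit Types (y q v : quat R) (F : quat R -> quat R).

Definition qn q : R := qx0 q ^+ 2 + qx1 q ^+ 2 + qx2 q ^+ 2 + qx3 q ^+ 2.

Definition qdot q v : R :=
  qx0 q * qx0 v + qx1 q * qx1 v + qx2 q * qx2 v + qx3 q * qx3 v.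

(** The map q |-> q^-1 - 1, written with real denominators; it maps the open ball
    with diameter [0, 1] onto the half-space x0 > 0. *)
Definition cayley y : quat R := (qn y)^-1 *: qconj y - 1.

(** The weight conj y / |y|^4 is the Fueter-Cauchy kernel; without it, composing
    with an inversion does not preserve regularity. *)
Definition kelvin F y : quat R := ((qn y)^-1 ^+ 2 *: qconj y) * F (cayley y).

Lemma is_derive_qx y v : [/\ is_derive y v (@qx0 R) (qx0 v),
  is_derive y v (@qx1 R) (qx1 v), is_derive y v (@qx2 R) (qx2 v) &
  is_derive y v (@qx3 R) (qx3 v)].
Proof. by split; exact: (is_derive_coord _ (is_derive_id y v)). Qed.

Lemma differentiable_qxi y i : differentiable (fun q : quat R => q 0 i) y.
Proof. exact: differentiable_coord. Qed.

Lemma is_derive_qn y v : is_derive y v qn (2 * qdot y v).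
Proof.
have [h0 h1 h2 h3] := is_derive_qx y v.
rewrite (_ : qn = fun q => qx0 q * qx0 q + qx1 q * qx1 q + qx2 q * qx2 q + qx3 q * qx3 q).
  by apply: is_derive_eq; rewrite /qdot /GRing.scale /=; ring.
by apply/funext => q; rewrite /qn !expr2.
Qed.

Lemma differentiable_qn y : differentiable qn y.
Proof.
have h i := differentiable_qxi y i.
rewrite (_ : qn = (fun q : quat R => q 0 0) * (fun q : quat R => q 0 0) +
  (fun q : quat R => q 0 1) * (fun q : quat R => q 0 1) +
  (fun q : quat R => q 0 2) * (fun q : quat R => q 0 2) +
  (fun q : quat R => q 0 3) * (fun q : quat R => q 0 3)).
  by do ![apply: differentiableD|apply: differentiableM].
by apply/funext => q; rewrite /qn !expr2.
Qed.

Lemma is_derive_qnV y v : qn y != 0 ->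
  is_derive y v (fun q => (qn q)^-1) (- ((qn y)^-1 ^+ 2) * (2 * qdot y v)).
Proof.
move=> ny; have [h1 h2] := is_derive_qn y v; split; first exact: derivableV.
by rewrite (deriveV ny h1) h2 exprVn.
Qed.

Lemma differentiable_qnV y : qn y != 0 -> differentiable (fun q => (qn q)^-1) y.
Proof. by move=> ny; apply: differentiableV => //; exact: differentiable_qn. Qed.

Lemma is_derive_qconj y v : is_derive y v (@qconj R) (qconj v).
Proof.
have [h0 h1 h2 h3] := is_derive_qx y v.
apply: is_derive_quat.
- by rewrite (_ : (fun q => _) = @qx0 R)//; apply/funext => q; rewrite qx_mk.
- rewrite (_ : (fun q => _) = fun q => - qx1 q); first exact: is_deriveN.
  by apply/funext => q; rewrite qx_mk.
- rewrite (_ : (fun q => _) = fun q => - qx2 q); first exact: is_deriveN.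
  by apply/funext => q; rewrite qx_mk.
- rewrite (_ : (fun q => _) = fun q => - qx3 q); first exact: is_deriveN.
  by apply/funext => q; rewrite qx_mk.
Qed.

Lemma differentiable_qconj y : differentiable (@qconj R) y.
Proof.
have h i := differentiable_qxi y i.
apply: differentiable_quat; elim/ord4_ind.
- by rewrite (_ : (fun q => _) = fun q : quat R => q 0 0)//; apply/funext => q; rewrite [LHS]qx0_mk.
- rewrite (_ : (fun q => _) = - (fun q : quat R => q 0 1)); first exact: differentiableN.
  by apply/funext => q; rewrite [LHS]qx1_mk.
- rewrite (_ : (fun q => _) = - (fun q : quat R => q 0 2)); first exact: differentiableN.
  by apply/funext => q; rewrite [LHS]qx2_mk.
- rewrite (_ : (fun q => _) = - (fun q : quat R => q 0 3)); first exact: differentiableN.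
  by apply/funext => q; rewrite [LHS]qx3_mk.
Qed.

Lemma is_derive_scale (U : normedModType R) (k : U -> R) (f : U -> quat R) (x w : U) dk df :
  is_derive x w k dk -> is_derive x w f df ->
  is_derive x w (fun z => k z *: f z) (dk *: f x + k x *: df).
Proof.
move=> hk hf.
have kf : is_derive x w (fun z => mkquat (k z) 0 0 0) (mkquat dk 0 0 0).
  apply: is_derive_quat.
  - by rewrite (_ : (fun z => _) = k)//; apply/funext => q; rewrite qx_mk.
  - by rewrite (_ : (fun z => _) = cst 0)//; [exact: is_derive_cst|apply/funext => q; rewrite qx_mk].
  - by rewrite (_ : (fun z => _) = cst 0)//; [exact: is_derive_cst|apply/funext => q; rewrite qx_mk].
  - by rewrite (_ : (fun z => _) = cst 0)//; [exact: is_derive_cst|apply/funext => q; rewrite qx_mk].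
have E (c : R) (q : quat R) : c *: q = mkquat c 0 0 0 * q.
  by apply: quatP; rewrite !qxE; ring.
rewrite (_ : (fun z => _) = fun z => mkquat (k z) 0 0 0 * f z).
  by rewrite !E; exact: is_derive_qmul.
by apply/funext => z; rewrite E.
Qed.

Lemma differentiable_scale (U : normedModType R) (k : U -> R) (f : U -> quat R) x :
  differentiable k x -> differentiable f x -> differentiable (fun z => k z *: f z) x.
Proof.
move=> dk df; apply: differentiable_quat => i.
rewrite (_ : (fun z => _) = k * (fun z => f z 0 i)).
  by apply: differentiableM => //; exact: differentiable_qx.
by apply/funext => z; rewrite mxE.
Qed.

Lemma is_derive_cayley y v : qn y != 0 ->
  is_derive y v cayley
    ((- ((qn y)^-1 ^+ 2) * (2 * qdot y v)) *: qconj y + (qn y)^-1 *: qconj v).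
Proof.
move=> ny; have h1 := is_derive_scale (is_derive_qnV v ny) (is_derive_qconj y v).
have h2 := is_derive_cst (1 : quat R) y v.
by have := is_deriveB h1 h2; rewrite subr0.
Qed.

Lemma differentiable_cayley y : qn y != 0 -> differentiable cayley y.
Proof.
move=> ny; apply: (differentiableB (g := cst (1 : quat R))) => //.
by apply: differentiable_scale; [exact: differentiable_qnV|exact: differentiable_qconj].
Qed.

Lemma is_derive_cauchy y v : qn y != 0 ->
  is_derive y v (fun q => (qn q)^-1 ^+ 2 *: qconj q)
    ((- 4 * (qn y)^-1 ^+ 3 * qdot y v) *: qconj y + (qn y)^-1 ^+ 2 *: qconj v).
Proof.
move=> ny; have h := is_derive_qnV v ny.
apply: is_derive_scale (is_derive_qconj y v).
rewrite (_ : (fun q => _) = (fun q => (qn q)^-1 * (qn q)^-1)).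
  by apply: is_derive_eq; rewrite /GRing.scale /=; ring.
by apply/funext => q; rewrite expr2.
Qed.

Lemma differentiable_kelvin F y : qn y != 0 -> differentiable F (cayley y) ->
  differentiable (kelvin F) y.
Proof.
move=> ny dF; have dn := differentiable_qnV ny.
apply: differentiable_qmul.
  apply: differentiable_scale; last exact: differentiable_qconj.
  rewrite (_ : (fun q => _) = (fun q => (qn q)^-1) * (fun q => (qn q)^-1)).
    exact: differentiableM.
  by apply/funext => q; rewrite expr2.
exact: (differentiable_comp (differentiable_cayley ny) dF).
Qed.

Lemma qdot_units y : [/\ qdot y 1 = qx0 y, qdot y (qi R) = qx1 y,
  qdot y (qj R) = qx2 y & qdot y (qk R) = qx3 y].
Proof.
have [i0 i1 i2 i3] := qx_qi R; have [j0 j1 j2 j3] := qx_qj R.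
have [k0 k1 k2 k3] := qx_qk R.
rewrite /qdot !qx_1 i0 i1 i2 i3 j0 j1 j2 j3 k0 k1 k2 k3.
by split; ring.
Qed.

Lemma qconj_units : [/\ qconj 1 = 1 :> quat R, qconj (qi R) = - qi R,
  qconj (qj R) = - qj R & qconj (qk R) = - qk R].
Proof.
have [i0 i1 i2 i3] := qx_qi R; have [j0 j1 j2 j3] := qx_qj R.
have [k0 k1 k2 k3] := qx_qk R.
split; apply: quatP; rewrite /qconj qx_mk.
all: rewrite ?qxN ?qx_1 ?i0 ?i1 ?i2 ?i3 ?j0 ?j1 ?j2 ?j3 ?k0 ?k1 ?k2 ?k3 //; ring.
Qed.

(** Groups the terms of the Fueter operator applied to E (F o phi): [A0 .. A3] are
    the partial derivatives of the weight E, [c l m] those of the m-th coordinate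
    of phi, and [L0 .. L3] those of F. *)
Lemma fueter_leibniz (A : algType R) (e1 e2 e3 A0 A1 A2 A3 E f L0 L1 L2 L3 : A)
    (c00 c01 c02 c03 c10 c11 c12 c13 c20 c21 c22 c23 c30 c31 c32 c33 : R) :
  A0 * f + E * (c00 *: L0 + c01 *: L1 + c02 *: L2 + c03 *: L3) +
  e1 * (A1 * f + E * (c10 *: L0 + c11 *: L1 + c12 *: L2 + c13 *: L3)) +
  e2 * (A2 * f + E * (c20 *: L0 + c21 *: L1 + c22 *: L2 + c23 *: L3)) +
  e3 * (A3 * f + E * (c30 *: L0 + c31 *: L1 + c32 *: L2 + c33 *: L3)) =
  (A0 + e1 * A1 + e2 * A2 + e3 * A3) * f +
  ((c00 *: 1 + c10 *: e1 + c20 *: e2 + c30 *: e3) * E * L0 +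
   (c01 *: 1 + c11 *: e1 + c21 *: e2 + c31 *: e3) * E * L1 +
   (c02 *: 1 + c12 *: e1 + c22 *: e2 + c32 *: e3) * E * L2 +
   (c03 *: 1 + c13 *: e1 + c23 *: e2 + c33 *: e3) * E * L3).
Proof.
have split5 (x B : A) d0 d1 d2 d3 :
    x * (B * f + E * (d0 *: L0 + d1 *: L1 + d2 *: L2 + d3 *: L3)) =
    x * B * f + d0 *: x * E * L0 + d1 *: x * E * L1 + d2 *: x * E * L2 +
    d3 *: x * E * L3.
  by rewrite !mulrDr -!scalerAr -!scalerAl !mulrA !addrA.
have sum5 (s t u v w s' t' u' v' w' : A) :
    s + t + u + v + w + (s' + t' + u' + v' + w') =
    (s + s') + (t + t') + (u + u') + (v + v') + (w + w').
  by rewrite (addrACA _ w) (addrACA _ v) (addrACA _ u) (addrACA _ t).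
rewrite -[A0 * f + _]mul1r !split5 mul1r (sum5 (A0 * f)).
rewrite (sum5 (A0 * f + e1 * A1 * f)) (sum5 (A0 * f + e1 * A1 * f + e2 * A2 * f)).
by rewrite -!mulrDl !addrA.
Qed.

(** The weight is itself regular, and the differential of y |-> y^-1 is
    v |-> - y^-1 v y^-1. Therefore the derivatives of F enter in the
    combination - |y|^-6 y (L0 + i L1 + j L2 + k L3), which is zero. *)
Lemma kelvin_fueter F y : qn y != 0 -> differentiable F (cayley y) ->
  fueter_op F (cayley y) = 0 -> fueter_op (kelvin F) y = 0.
Proof.
move=> ny dF fF.
have D v := is_derive_qmul (is_derive_cauchy v ny)
  (is_derive_comp dF (differentiable_cayley ny) (is_derive_cayley v ny)).
have {}D v : 'D_v (kelvin F) y = _ := @derive_val _ _ _ _ _ _ _ (D v).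
rewrite /fueter_op !D !(diff_partials _ dF).
move: fF; rewrite /fueter_op.
set L0 := 'D_(1 : quat R) F _; set L1 := 'D_(qi R) F _.
set L2 := 'D_(qj R) F _; set L3 := 'D_(qk R) F _.
set f := F _; set m := (qn y)^-1 => fF.
have nm : qn y * m = 1 by rewrite divff.
have [-> -> -> ->] := qdot_units y; have [-> -> -> ->] := qconj_units.
rewrite fueter_leibniz.
have [c0 c1 c2 c3] := qx_qconj y.
have [i0 i1 i2 i3] := qx_qi R; have [j0 j1 j2 j3] := qx_qj R.
have [k0 k1 k2 k3] := qx_qk R.
move: (qconj y) c0 c1 c2 c3 => Y c0 c1 c2 c3.
clear D dF; move: (qi R) (qj R) (qk R) i0 i1 i2 i3 j0 j1 j2 j3 k0 k1 k2 k3 L0 L1 L2 L3 f m nm fF =>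
  I J K i0 i1 i2 i3 j0 j1 j2 j3 k0 k1 k2 k3 L0 L1 L2 L3 f m nm fF.
have Eq := (qxM, qxD, qxN, qxZ, qx_1).
have Ec := (i0, i1, i2, i3, j0, j1, j2, j3, k0, k1, k2, k3, c0, c1, c2, c3).
(* Each coefficient is its final value plus a multiple of 1 - |y|^2 m = 0. *)
set A := (X in X * f).
have -> : A = (4 * m ^+ 2 * (1 - qn y * m))%:A.
  by apply: quatP; rewrite /A !Eq !Ec /qn; ring.
set B0 := (X in X * L0); set B1 := (X in X * L1).
set B2 := (X in X * L2); set B3 := (X in X * L3).
have -> : B0 = (2 * m ^+ 3 * qx0 y * (1 - qn y * m))%:A - m ^+ 3 *: y.
  by apply: quatP; rewrite /B0 !Eq !Ec /qn; ring.
have -> : B1 = (- 2 * m ^+ 3 * qx1 y * (1 - qn y * m))%:A - m ^+ 3 *: (y * I).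
  by apply: quatP; rewrite /B1 !Eq !Ec /qn; ring.
have -> : B2 = (- 2 * m ^+ 3 * qx2 y * (1 - qn y * m))%:A - m ^+ 3 *: (y * J).
  by apply: quatP; rewrite /B2 !Eq !Ec /qn; ring.
have -> : B3 = (- 2 * m ^+ 3 * qx3 y * (1 - qn y * m))%:A - m ^+ 3 *: (y * K).
  by apply: quatP; rewrite /B3 !Eq !Ec /qn; ring.
rewrite nm subrr !mulr0 !scale0r mul0r !add0r.
rewrite !mulNr -!opprD -!scalerAl -!scalerDr -!mulrA -!mulrDr fF.
by rewrite mulr0 scaler0 oppr0.
Qed.

End Inversion.

(** * Regular functions with compactly supported slices *)

Section SlabUniqueness.
Variable R : realType.
Implicit Types (c : quat R) (e : 'I_4 -> nat).

Lemma enum4 : enum 'I_4 = [:: 0; 1; 2; 3].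
Proof. by apply: (inj_map val_inj); rewrite val_enum_ord. Qed.

Lemma others0 : others (0 : 'I_4) = [:: 1; 2; 3].
Proof. by rewrite /others enum4. Qed.

Let sp := others (0 : 'I_4).

Let mem_sp l : (l \in sp) = (l != 0). Proof. exact: mem_others. Qed.

Definition mono e (x : 'rV[R]_4) : R := \prod_(l <- sp) x 0 l ^+ e l.

Lemma monoE e x : mono e x = x 0 1 ^+ e 1 * (x 0 2 ^+ e 2 * x 0 3 ^+ e 3).
Proof. by rewrite /mono /sp others0 !big_cons big_nil mulr1. Qed.

(** With [mult], the derivative of a monomial along the direction [l]. *)
Definition lower (l : 'I_4) e : 'I_4 -> nat := fun m => (e m - (m == l))%N.

Definition mult (l : 'I_4) e : nat := if l == 0 then 0%N else e l.

Lemma is_derive_entry (x : 'rV[R]_4) l m :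
  is_derive x ('e_l : 'rV[R]_4) (fun y : 'rV[R]_4 => y 0 m) (l == m)%:R.
Proof.
apply: is_derive_eq; first exact: (is_derive_coord m (is_derive_id x ('e_l : quat R))).
by rewrite !mxE eqxx eq_sym.
Qed.

Lemma is_derive_mono e x l :
  is_derive x ('e_l : 'rV[R]_4) (mono e) ((mult l e)%:R * mono (lower l e) x).
Proof.
have E : mono e = fun y => y 0 1 ^+ e 1 * (y 0 2 ^+ e 2 * y 0 3 ^+ e 3).
  by apply/funext => y; rewrite monoE.
rewrite E monoE /mult /lower.
have D m : is_derive x ('e_l : 'rV[R]_4) (fun y : 'rV[R]_4 => y 0 m ^+ e m)
    ((e m)%:R * x 0 m ^+ (e m).-1 * (l == m)%:R).
  have := @is_deriveX _ _ (fun y : 'rV[R]_4 => y 0 m) (e m) x 'e_l _ (is_derive_entry x l m).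
  rewrite (_ : (fun y : 'rV[R]_4 => y 0 m) ^+ e m = fun y : 'rV[R]_4 => y 0 m ^+ e m)//.
  by apply/funext => y; rewrite exprfctE.
have := is_deriveM (D 1) (is_deriveM (D 2) (D 3)).
move=> H; apply: is_derive_eq H _; rewrite /GRing.scale /= mulrfctE.
by elim/ord4_ind: l {D} => /=; rewrite ?subn0 ?subn1; ring.
Qed.

Lemma differentiable_mono e x : differentiable (mono e) x.
Proof.
have D m : differentiable ((fun y : 'rV[R]_4 => y 0 m) ^+ e m) x.
  case: (e m) => [|j]; first by rewrite expr0; exact: differentiable_cst.
  by apply: differentiableX; exact: differentiable_coord.
have -> : mono e = (fun y : 'rV[R]_4 => y 0 1) ^+ e 1 *
    ((fun y : 'rV[R]_4 => y 0 2) ^+ e 2 * (fun y : 'rV[R]_4 => y 0 3) ^+ e 3).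
  by apply/funext => y; rewrite monoE !mulrfctE !exprfctE.
exact: (differentiableM (D 1) (differentiableM (D 2) (D 3))).
Qed.

(** The function [W] is a regular function G read in the coordinates
    (log t, x1, x2, x3), which are global on t > 0. Hence the factor [k]: the
    equation reads d/ds W + exp(s) (i d1 + j d2 + k d3) W = 0. *)

Variable W : quat R -> quat R.
Hypothesis dW : forall x, differentiable W x.
Let k (l : 'I_4) (x : 'rV[R]_4) : R := if l == 0 then 1 else expR (x 0 0).
Hypothesis eqW : forall x : quat R,
  \sum_(l < 4) k l x *: (('e_l : quat R) * 'D_('e_l : quat R) W x) = 0.
Hypothesis W0 : forall x : quat R, 0 <= x 0 0 -> W x = 0.
Hypothesis W1 : forall (x : quat R) l, l != 0 -> `|x 0 l| = 1 -> W x = 0.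

Let A : 'rV[R]_4 := const_mx (-1).
Let B : 'rV[R]_4 := const_mx 1.

(** The left factor [c] is arbitrary because the integration by parts turns it
    into c i, c j or c k. *)
Definition moment e c (r : 'I_4) (x : 'rV[R]_4) : R :=
  jbox sp A B (fun y => mono e y * (c * W y) 0 r) x.

Let V e c r (l : 'I_4) (x : quat R) : R := mono e x * (k l x * (c * 'e_l * W x) 0 r).

Let K e c r (x : quat R) : R :=
  \sum_(l < 4) (mult l e)%:R * k l x * (mono (lower l e) x * (c * 'e_l * W x) 0 r).

Lemma k_derive l x : is_derive x ('e_l : 'rV[R]_4) (k l) 0.
Proof.
rewrite /k; have [->|l0] := eqVneq l 0; first exact: is_derive_cst.
apply: is_derive_along => h; congr expR.
by rewrite !mxE eqxx eq_sym (negbTE l0) mulr0 add0r.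
Qed.

Lemma k_diff l x : differentiable (k l) x.
Proof.
rewrite /k; case: eqVneq => [_|l0]; first exact: differentiable_cst.
apply: (@differentiable_comp _ _ _ _ (fun y : 'rV[R]_4 => y 0 0) expR).
  exact: differentiable_coord.
by apply/derivable1_diffP; exact: derivable_expR.
Qed.

Lemma term_diff c r x : differentiable (fun y => (c * W y) 0 r) x.
Proof.
by apply: differentiable_qx; apply: differentiable_qmul.
Qed.

Lemma V_diff e c r l x : differentiable (V e c r l) x.
Proof.
apply: (differentiableM (f := mono e) (g := fun y => k l y * (c * 'e_l * W y) 0 r)).
  exact: differentiable_mono.
apply: (differentiableM (f := k l) (g := fun y => (c * 'e_l * W y) 0 r)).
  exact: k_diff.
exact: term_diff.
Qed.

(** The derivatives of W cancel by the equation. Only those of the monomial, which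
    lower its degree, remain. *)
Lemma V_div e c r x : \sum_(l < 4) 'd (V e c r l) x 'e_l = K e c r x.
Proof.
rewrite -[RHS]addr0.
have D l : is_derive x ('e_l : quat R) (V e c r l)
    ((mult l e)%:R * k l x * (mono (lower l e) x * (c * 'e_l * W x) 0 r) +
     mono e x * (k l x * (c * 'e_l * 'D_('e_l) W x) 0 r)).
  have h1 := is_derive_mono e x l.
  have h2 := k_derive l x.
  have h3 : is_derive x ('e_l : quat R) (fun y => c * 'e_l * W y) (c * 'e_l * 'D_('e_l) W x).
    have hc := is_derive_cst (c * 'e_l) x ('e_l : quat R).
    have := is_derive_qmul hc (derivableP (diff_derivable (dW x))).
    by rewrite mul0r add0r.
  have h4 := is_derive_coord r h3.
  have := is_deriveM h1 (is_deriveM h2 h4).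
  by move=> H; apply: is_derive_eq H _; rewrite /GRing.scale /= mulrfctE; ring.
rewrite (eq_bigr (fun l => 'D_('e_l : quat R) (V e c r l) x)); last first.
  by move=> l _; rewrite deriveE//; exact: V_diff.
rewrite (eq_bigr _ (fun l _ => @derive_val _ _ _ _ _ _ _ (D l))) big_split /=.
congr (_ + _); rewrite -mulr_sumr.
have -> : \sum_(l < 4) k l x * (c * 'e_l * 'D_('e_l) W x) 0 r =
    (c * \sum_(l < 4) k l x *: (('e_l : quat R) * 'D_('e_l : quat R) W x)) 0 r.
  rewrite mulr_sumr summxE; apply: eq_bigr => l _.
  by rewrite -scalerAr mulrA [RHS]mxE.
by rewrite eqW mulr0 mxE mulr0.
Qed.

Let cmono e : continuous (mono e).
Proof. by move=> x; exact: differentiable_continuous (differentiable_mono e x). Qed.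

Let ck l : continuous (k l).
Proof. by move=> x; exact: differentiable_continuous (k_diff l x). Qed.

Let cterm c r : continuous (fun x : 'rV[R]_4 => (c * W x) 0 r).
Proof. by move=> x; exact: differentiable_continuous (term_diff c r x). Qed.

Let AB : lebox A B. Proof. by move=> i; rewrite !mxE; lra. Qed.

Let cmom e c r : continuous (fun x : 'rV[R]_4 => mono e x * (c * W x) 0 r).
Proof. exact: (contM (@cmono e) (@cterm c r)). Qed.

Let csummand e c r l : continuous (fun x : 'rV[R]_4 =>
  (mult l e)%:R * k l x * (mono (lower l e) x * (c * 'e_l * W x) 0 r)).
Proof.
apply: contM; last exact: cmom.
by apply: contM => //; exact: cont_cst.
Qed.

Lemma K_cont e c r : continuous (K e c r).
Proof.
have -> : K e c r = fun x : 'rV[R]_4 => \sum_(l <- enum 'I_4)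
    (mult l e)%:R * k l x * (mono (lower l e) x * (c * 'e_l * W x) 0 r).
  by apply/funext => x; rewrite big_enum.
elim: (enum 'I_4) => [|l s IH].
  rewrite (_ : (fun x => _) = fun=> 0); first exact: cont_cst.
  by apply/funext => x; rewrite big_nil.
rewrite (_ : (fun x => _) = fun x : 'rV[R]_4 => (mult l e)%:R * k l x *
    (mono (lower l e) x * (c * 'e_l * W x) 0 r) + \sum_(l <- s)
    (mult l e)%:R * k l x * (mono (lower l e) x * (c * 'e_l * W x) 0 r)).
  by apply: contD => //; exact: csummand.
by apply/funext => x; rewrite big_cons.
Qed.

Lemma moment_late e c r (x : 'rV[R]_4) : 0 <= x 0 0 -> moment e c r x = 0.
Proof.
move=> x0; apply: jbox_eq0 => y yx.
by rewrite (W0 (x := y)) ?mulr0 ?yx ?mem_sp ?mxE ?mulr0.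
Qed.

Lemma flux_lateral e c r l (a b : 'rV[R]_4) : l != 0 -> a 0 l = -1 -> b 0 l = 1 ->
  flux l a b (V e c r l) = 0.
Proof.
move=> l0 al bl; apply: jbox_eq0 => y _; rewrite /face /V.
have Wl (u : R) : `|u| = 1 -> W (upd l u y) = 0.
  by move=> u1; apply: (W1 (l := l)) => //; rewrite updE eqxx.
rewrite !Wl ?al ?bl ?normrN ?normr1//.
by rewrite !mulr0 !mxE !mulr0 subrr.
Qed.

(** The divergence theorem on the slab between s and 0 equates the moment at s with
    an integral of moments of lower degree: W is zero on the lateral faces and on
    the slice at 0. *)
Lemma moment_eq0 e c r (x : 'rV[R]_4) : moment e c r x = 0.
Proof.
have [N] := ubnP (\sum_(l <- sp) e l)%N.
elim: N e c x => // N IH e c x; rewrite ltnS => eN.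
have [x0|x0] := leP 0 (x 0 0); first exact: moment_late.
pose a := upd 0 (x 0 0) A; pose b := upd 0 0 B.
have ab : lebox a b.
  by move=> i; rewrite !updE !mxE; case: eqP => _; [exact: ltW|lra].
have := divergence_box (@V_diff e c r) (@K_cont e c r) (@V_div e c r) ab.
rewrite (bigD1 0)//= [X in _ + X]big1 ?addr0; last first.
  move=> l l0; apply: flux_lateral => //.
    by rewrite updE (negbTE l0) mxE.
  by rewrite updE (negbTE l0) mxE.
have spab f : jbox sp a b f = jbox sp A B f.
  by apply: jbox_eq_box => i; rewrite mem_sp => i0; rewrite !updE (negbTE i0).
have c0 : 0 \notin sp by rewrite mem_sp eqxx.
have cV : continuous (V e c r 0).
  by move=> y; exact: differentiable_continuous (V_diff e c r 0 y).
have unit0 : ('e_0 : quat R) = 1.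
  by apply: quatP; rewrite qx_1 /qx0 /qx1 /qx2 /qx3 !mxE.
have mE u : moment e c r (upd 0 u 0) = jbox sp A B (fun y => V e c r 0 (upd 0 u y)) 0.
  rewrite jbox_upd// /moment; congr (jbox _ _ _ _ _).
  apply/funext => y; rewrite /V /k eqxx mul1r; 
  by rewrite unit0 mulr1.
have -> : flux 0 a b (V e c r 0) =
    moment e c r (upd 0 0 0) - moment e c r (upd 0 (x 0 0) 0).
  rewrite /flux -/sp spab /face !updE eqxx jboxB//; first by rewrite !mE.
  - exact: (@comp_updl _ _ _ 0 0 cV).
  - exact: (@comp_updl _ _ _ 0 (x 0 0) cV).
rewrite moment_late ?sub0r; last by rewrite updE eqxx.
have -> : moment e c r (upd 0 (x 0 0) 0) = moment e c r x.
  by apply: jbox_indep => i; rewrite mem_sp negbK => /eqP ->; rewrite updE eqxx.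
suff -> : vol a b (K e c r) = 0 by move=> /eqP; rewrite oppr_eq0 => /eqP.
rewrite /vol enum4 -others0 -/sp /= /jint.
rewrite (_ : (fun u => _) = fun=> 0); first by rewrite /pint /Rintegral integral0.
apply/funext => u; rewrite spab jbox_sum//.
apply: big1 => l _.
have kE (y : 'rV[R]_4) : (mult l e)%:R * k l y * (mono (lower l e) y * (c * 'e_l * W y) 0 r) =
   ((mult l e)%:R * k l y) * (mono (lower l e) y * (c * 'e_l * W y) 0 r) by [].
rewrite (jbox_pull (h := fun y : 'rV[R]_4 => (mult l e)%:R * k l y) AB)//; last first.
  move=> m v y; rewrite mem_sp /k => m0; case: eqP => // _.
  by rewrite updE eq_sym (negbTE m0).
rewrite /mult; have [->|l0] := eqVneq l 0; first by rewrite !mul0r.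
case el : (e l) => [|j]; first by rewrite !mul0r.
rewrite -/(moment (lower l e) (c * 'e_l) r (upd 0 u 0)) IH ?mulr0//.
apply: leq_trans eN; rewrite /sp (bigD1_seq l) ?mem_others ?others_uniq//=.
rewrite [X in (_ < X)%N](bigD1_seq l) ?mem_others ?others_uniq//=.
rewrite /lower eqxx el subn1 /= -addnS addnC addSn ltnS addnC leq_add2l.
by apply: leq_sum => m _; rewrite leq_subr.
Qed.

Theorem slab_uniqueness (x : quat R) :
  (forall l, l != 0 -> -1 <= x 0 l <= 1) -> W x = 0.
Proof.
move=> x1; apply/rowP => r; rewrite mxE.
have c1 : continuous (fun y : 'rV[R]_4 => (1 * W y : quat R) 0 r).
  exact: (@cterm 1 r).
rewrite -[W x]mul1r.
apply: (jbox_moments AB (f := fun y : 'rV[R]_4 => (1 * W y : quat R) 0 r) (others_uniq (0 : 'I_4)) c1).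
- by move=> l _; rewrite !mxE.
- by move=> e; exact: (moment_eq0 e 1 r x).
- by move=> l; rewrite mem_others => /x1.
Qed.

End SlabUniqueness.

(** * Uniqueness of the Cauchy-Kowalevskaya extension *)

Section CKUniqueness.
Variable R : realType.
Implicit Types (F : quat R -> quat R) (q y : quat R).

Lemma diff_charac (U V : normedModType R) (f : U -> V) (df : {linear U -> V}) p :
  continuous df ->
  (forall e : R, 0 < e ->
    \forall x \near p, `|f x - f p - df (x - p)| <= e * `|x - p|) ->
  differentiable f p /\ 'd f p = df :> (U -> V).
Proof.
move=> cdf H.
have E : f \o shift p = cst (f p) + df +o_ (0 : U) id.
  apply/eqaddoP => e e0; have := H e e0.
  rewrite (near_shift 0 p) subr0 /=; apply: filterS => x /=.
  by rewrite !fctE /= addrK opprD addrA.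
have D := diff_unique cdf E.
by split=> //; apply/diff_locallyP; rewrite D.
Qed.

Lemma diff_near_eq (U V : normedModType R) (f g : U -> V) p :
  (\forall x \near p, f x = g x) -> differentiable f p ->
  differentiable g p /\ 'd g p = 'd f p :> (U -> V).
Proof.
move=> fg df; apply: diff_charac; first exact: diff_continuous.
move=> e e0; have gp := nbhs_singleton fg.
near=> x; rewrite -gp -(near fg x)//; near: x; exact: diff_estimate.
Unshelve. all: by end_near. Qed.

Lemma diff_flat (U V : normedModType R) (f : U -> V) p : f p = 0 ->
  (forall e : R, 0 < e -> \forall x \near p, `|f x| <= e * `|x - p|) ->
  differentiable f p /\ 'd f p = (fun=> 0) :> (U -> V).
Proof.
move=> fp H; have d0 := diff_cst (0 : V) p.
have [|e e0|h1 h2] := @diff_charac _ _ f ('d (cst (0 : V)) p) p.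
- exact: diff_continuous.
- by apply: filterS (H e e0) => x; rewrite d0 fp !subr0.
- split; first exact: h1.
  by apply/funext => x; rewrite h2 d0.
Qed.

Lemma fueter_opE F q : differentiable F q -> fueter_op F q =
  'd F q 1 + qi R * 'd F q (qi R) + qj R * 'd F q (qj R) + qk R * 'd F q (qk R).
Proof. by move=> dF; rewrite /fueter_op !deriveE. Qed.

Definition zero_ext F q : quat R := if 0 < qx0 q then F q else 0.

Lemma qx0_continuous : continuous (@qx0 R).
Proof. exact: coord_continuous. Qed.

(** On x0 = 0 the differential of [F] vanishes, so gluing [F] with 0 keeps
    differentiability there. *)
Lemma zero_ext_regular F : (forall q, differentiable F q /\ fueter_op F q = 0) ->
  (forall q, qx0 q = 0 -> F q = 0) ->
  forall q, differentiable (zero_ext F) q /\ fueter_op (zero_ext F) q = 0.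
Proof.
move=> rF F0 q; have [dF fF] := rF q.
have [q0|q0|q0] := ltgtP (qx0 q) 0.
- have N : \forall x \near q, cst 0 x = zero_ext F x.
    have H : \forall x \near q, qx0 x < 0.
      exact: (cvgr_lt _ (@qx0_continuous q) _ q0).
    apply: filterS H => x xq.
    by rewrite /zero_ext ltNge ltW.
  have [dZ ZE] := diff_near_eq N (differentiable_cst (0 : quat R) q).
  have Z0 v : 'd (zero_ext F) q v = 0 by rewrite ZE diff_cst.
  by split; [exact: dZ|rewrite (fueter_opE dZ) !Z0 !mulr0 !addr0].
- have N : \forall x \near q, F x = zero_ext F x.
    have H : \forall x \near q, 0 < qx0 x.
      exact: (cvgr_gt _ (@qx0_continuous q) _ q0).
    apply: filterS H => x xq.
    by rewrite /zero_ext xq.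
  have [dZ ZE] := diff_near_eq N dF.
  by split; [exact: dZ|rewrite (fueter_opE dZ) ZE -fueter_opE].
- have flat v : qx0 v = 0 -> 'D_v F q = 0.
    move=> v0; apply: (@derive_val _ _ _ _ _ _ _ (is_derive_along (v := v) _)) => h.
    by rewrite !F0// !qxE v0 q0 mulr0 addr0.
  have [i0 _ _ _] := qx_qi R; have [j0 _ _ _] := qx_qj R; have [k0 _ _ _] := qx_qk R.
  have D1 : 'D_(1 : quat R) F q = 0.
    by move: fF; rewrite /fueter_op !(flat _ i0) !(flat _ j0) !(flat _ k0) !mulr0 !addr0.
  have dF0 v : 'd F q v = 0.
    by rewrite diff_partials// D1 !(flat _ i0) !(flat _ j0) !(flat _ k0) !scaler0 !addr0.
  have [|e e0|dZ ZE] := @diff_flat _ _ (zero_ext F) q.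
  + by rewrite /zero_ext q0 ltxx.
  + apply: filterS (diff_estimate dF e0) => x; rewrite dF0 (F0 q q0) !subr0 /zero_ext.
    by case: ifP => // _ _; rewrite normr0 mulr_ge0// ltW.
  have Z0 v : 'd (zero_ext F) q v = 0 by rewrite ZE.
  by split; [exact: dZ|rewrite (fueter_opE dZ) !Z0 !mulr0 !addr0].
Qed.

(** The change of variable t = exp(s), which turns t > 0 into the whole space. *)
Definition slab (x : quat R) : quat R := mkquat (expR (qx0 x)) (qx1 x) (qx2 x) (qx3 x).

Lemma sum4 (V : nmodType) (f : 'I_4 -> V) : \sum_(l < 4) f l = f 0 + f 1 + f 2 + f 3.
Proof.
rewrite !big_ord_recl big_ord0 addr0 !addrA.
by congr (_ + f _ + f _ + f _); apply: val_inj.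
Qed.

Lemma quat_units : [/\ ('e_0 : quat R) = 1, ('e_1 : quat R) = qi R,
  ('e_2 : quat R) = qj R & ('e_3 : quat R) = qk R].
Proof.
have [i0 i1 i2 i3] := qx_qi R; have [j0 j1 j2 j3] := qx_qj R.
have [k0 k1 k2 k3] := qx_qk R.
by split; apply: quatP; rewrite ?qx_1 ?i0 ?i1 ?i2 ?i3 ?j0 ?j1 ?j2 ?j3 ?k0 ?k1 ?k2 ?k3
  /qx0 /qx1 /qx2 /qx3 !mxE.
Qed.

Lemma qn_gt0 y : 0 < qx0 y -> 0 < qn y.
Proof. by move=> y0; rewrite /qn -!addrA ltr_wpDr ?exprn_gt0// !addr_ge0 ?sqr_ge0. Qed.

Lemma differentiable_slab x : differentiable slab x.
Proof.
have h i := differentiable_qxi x i.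
apply: differentiable_quat; elim/ord4_ind.
- rewrite (_ : (fun y => _) = fun y : quat R => expR (y 0 0)).
    apply: (@differentiable_comp _ _ _ _ (fun y : quat R => y 0 0) expR) => //.
    by apply/derivable1_diffP; exact: derivable_expR.
  by apply/funext => y; rewrite [LHS]qx0_mk.
- by rewrite (_ : (fun y => _) = fun y : quat R => y 0 1)//; apply/funext => y; rewrite [LHS]qx1_mk.
- by rewrite (_ : (fun y => _) = fun y : quat R => y 0 2)//; apply/funext => y; rewrite [LHS]qx2_mk.
- by rewrite (_ : (fun y => _) = fun y : quat R => y 0 3)//; apply/funext => y; rewrite [LHS]qx3_mk.
Qed.

Lemma is_derive_expR_comp (x v : quat R) :
  is_derive x v (fun y : quat R => expR (qx0 y)) (expR (qx0 x) * qx0 v).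
Proof.
have d0 : differentiable (@qx0 R) x by exact: differentiable_coord.
have de : differentiable expR (qx0 x).
  by apply/derivable1_diffP; exact: derivable_expR.
have dc : differentiable (expR \o @qx0 R) x by exact: differentiable_comp.
split; first exact: diff_derivable.
rewrite -[LHS]/('D_v (expR \o @qx0 R) x) deriveE// diff_comp//=.
have [h0 _ _ _] := is_derive_qx x v.
rewrite -(deriveE v d0) (@derive_val _ _ _ _ _ _ _ h0).
rewrite -[qx0 v]mulr1 -[_ * 1]/(qx0 v *: (1 : R)) linearZ /= -deriveE//.
rewrite (@derive_val _ _ _ _ _ _ _ (is_derive_expR (qx0 x))).
by rewrite /GRing.scale /= mulr1 mulrC.
Qed.

Lemma is_derive_slab (x v : quat R) :
  is_derive x v slab (mkquat (expR (qx0 x) * qx0 v) (qx1 v) (qx2 v) (qx3 v)).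
Proof.
have [h0 h1 h2 h3] := is_derive_qx x v.
apply: is_derive_quat.
- rewrite (_ : (fun y => _) = fun y : quat R => expR (qx0 y)).
    exact: is_derive_expR_comp.
  by apply/funext => y; rewrite qx_mk.
- by rewrite (_ : (fun y => _) = @qx1 R)//; apply/funext => y; rewrite qx_mk.
- by rewrite (_ : (fun y => _) = @qx2 R)//; apply/funext => y; rewrite qx_mk.
- by rewrite (_ : (fun y => _) = @qx3 R)//; apply/funext => y; rewrite qx_mk.
Qed.

Lemma slab_gt0 x : 0 < qx0 (slab x).
Proof. by rewrite qx_mk expR_gt0. Qed.

(** The real part of y^-1 - 1 is t / |y|^2 - 1, which is nonpositive outside
    the open ball t > |y|^2. *)
Lemma zero_ext_cayley F y : 0 < qn y -> qx0 y <= qn y -> zero_ext F (cayley y) = 0.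
Proof.
move=> n0 yn; rewrite /zero_ext /cayley ifF//; apply/negbTE.
by rewrite -leNgt !qxE subr_le0 mulrC ler_pdivrMr// mul1r.
Qed.

Lemma scale_sum (a : R) (p1 p2 p3 q0 q1 q2 q3 : quat R) :
  1 *: (1 * (a *: q0)) + a *: (p1 * q1) + a *: (p2 * q2) + a *: (p3 * q3) =
  a *: (q0 + p1 * q1 + p2 * q2 + p3 * q3).
Proof. by rewrite !scalerDr scale1r mul1r. Qed.

(** The Kelvin transform of the extension by zero satisfies the hypotheses of
    [slab_uniqueness]: on t >= 1 and on the planes x_l = 1 and x_l = -1 one has
    t <= |y|^2. Every q with x0 > 0 is [cayley y] for y = (q + 1)^-1. *)
Lemma regular_flat_pos F : (forall q, differentiable F q /\ fueter_op F q = 0) ->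
  (forall q, qx0 q = 0 -> F q = 0) -> forall q, 0 < qx0 q -> F q = 0.
Proof.
move=> rF F0 q q0.
pose Z := zero_ext F; have rZ := zero_ext_regular rF F0.
have ns x : qn (slab x) != 0 by rewrite gt_eqF// qn_gt0// slab_gt0.
have dk x : differentiable (kelvin Z) (slab x).
  by apply: differentiable_kelvin => //; have [] := rZ (cayley (slab x)).
have fk x : fueter_op (kelvin Z) (slab x) = 0.
  by have [h1 h2] := rZ (cayley (slab x)); exact: kelvin_fueter.
pose W x := kelvin Z (slab x).
have dW x : differentiable W x.
  exact: (differentiable_comp (differentiable_slab x) (dk x)).
have DW x v : 'D_v W x = 'd (kelvin Z) (slab x)
    (mkquat (expR (qx0 x) * qx0 v) (qx1 v) (qx2 v) (qx3 v)).
  exact: (@derive_val _ _ _ _ _ _ _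
    (is_derive_comp (dk x) (differentiable_slab x) (is_derive_slab x v))).
have DW0 x : 'D_(1 : quat R) W x = expR (qx0 x) *: 'D_(1 : quat R) (kelvin Z) (slab x).
  rewrite DW (deriveE _ (dk x)) -linearZ; congr ('d _ _ _).
  by apply: quatP; rewrite qx_mk qxZ !qx_1 ?mulr0.
have DWl x v : qx0 v = 0 -> 'D_v W x = 'D_v (kelvin Z) (slab x).
  move=> v0; rewrite DW (deriveE _ (dk x)); congr ('d _ _ _).
  by apply: quatP; rewrite qx_mk ?v0 ?mulr0.
have [u0 u1 u2 u3] := quat_units.
have [i0 _ _ _] := qx_qi R; have [j0 _ _ _] := qx_qj R; have [k0 _ _ _] := qx_qk R.
have eqW (x : quat R) : \sum_(l < 4) (if l == 0 then 1 else expR (x 0 0)) *: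
    (('e_l : quat R) * 'D_('e_l : quat R) W x) = 0.
  rewrite sum4 /= u0 u1 u2 u3 DW0 (DWl _ _ i0) (DWl _ _ j0) (DWl _ _ k0).
  apply: etrans (scale_sum _ _ _ _ _ _ _ _) _.
  apply: (etrans _ (scaler0 _ (expR (qx0 x)))).
  exact: (congr1 _ (fk x)).
have Wn x : qx0 (slab x) <= qn (slab x) -> W x = 0.
  by move=> h; rewrite /W /kelvin /Z zero_ext_cayley ?mulr0// qn_gt0// slab_gt0.
have sq (x : quat R) : [/\ 0 <= qx1 x ^+ 2, 0 <= qx2 x ^+ 2 & 0 <= qx3 x ^+ 2].
  by rewrite !sqr_ge0.
have W0 (x : quat R) : 0 <= x 0 0 -> W x = 0.
  move=> x0; apply: Wn; rewrite /qn !qx_mk; have [? ? ?] := sq x.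
  have : 1 <= expR (qx0 x) by rewrite -expR0 ler_expR.
  by nra.
have W1 (x : quat R) l : l != 0 -> `|x 0 l| = 1 -> W x = 0.
  move=> l0 xl; apply: Wn; rewrite /qn !qx_mk; have [? ? ?] := sq x.
  have : 1 <= qx1 x ^+ 2 + qx2 x ^+ 2 + qx3 x ^+ 2.
    have : x 0 l ^+ 2 = 1 by rewrite -(real_normK (num_real _)) xl expr1n.
    by elim/ord4_ind: l l0 xl => //= _ _; rewrite -/(qx1 x) -/(qx2 x) -/(qx3 x) => ->; lra.
  by nra.
pose N := qn (q + 1).
have N0 : 0 < N by rewrite qn_gt0// !qxE; lra.
have NE : N = (qx0 q + 1) ^+ 2 + qx1 q ^+ 2 + qx2 q ^+ 2 + qx3 q ^+ 2.
  by rewrite /N /qn !qxE !addr0.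
pose y : quat R := N^-1 *: qconj (q + 1).
have [c0 c1 c2 c3] := qx_qconj (q + 1).
have yE : [/\ qx0 y = N^-1 * (qx0 q + 1), qx1 y = N^-1 * - qx1 q,
    qx2 y = N^-1 * - qx2 q & qx3 y = N^-1 * - qx3 q].
  by rewrite /y !qxZ c0 c1 c2 c3 !qxE !addr0.
have [y0 y1 y2 y3] := yE.
have yp : 0 < qx0 y by rewrite y0 mulr_gt0 ?invr_gt0//; lra.
pose x : quat R := mkquat (ln (qx0 y)) (qx1 y) (qx2 y) (qx3 y).
have xy : slab x = y.
  by apply: quatP; rewrite !qx_mk// lnK// posrE.
have ny : qn y = N^-1.
  rewrite /qn y0 y1 y2 y3 !exprMn !sqrrN -!mulrDr -NE expr2 -mulrA mulVf ?mulr1//.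
  by rewrite gt_eqF.
have cy : qconj y = N^-1 *: (q + 1).
  by apply: quatP; rewrite /qconj !qx_mk ?y0 ?y1 ?y2 ?y3 !qxE; ring.
have cay : cayley y = q.
  by rewrite /cayley ny cy invrK scalerA divff ?gt_eqF// scale1r addrK.
have Wx : W x = 0.
  apply: (slab_uniqueness dW eqW W0 W1) => l l0.
  (* |q_l| / N <= 1 since N >= 1 + q_l^2. *)
have b (t : R) : t ^+ 2 <= N - 1 -> -1 <= N^-1 * - t <= 1.
    move=> tN; rewrite -ler_norml normrM normrN gtr0_norm ?invr_gt0//.
    rewrite mulrC ler_pdivrMr// mul1r ler_norml; apply/andP; split; nra.
  elim/ord4_ind: l l0 => //= _.
  - rewrite [x 0 1]qx1_mk y1; apply: b; rewrite NE; have [? ? ?] := sq q; nra.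
  - rewrite [x 0 2]qx2_mk y2; apply: b; rewrite NE; have [? ? ?] := sq q; nra.
  - rewrite [x 0 3]qx3_mk y3; apply: b; rewrite NE; have [? ? ?] := sq q; nra.
move: Wx; rewrite /W xy /kelvin cay ny invrK cy /Z /zero_ext q0 => H.
have : (qconj (q + 1)) * ((N ^+ 2 *: (N^-1 *: (q + 1))) * F q) = 0 by rewrite H mulr0.
rewrite scalerA -scalerAl -scalerAr mulrA.
have -> : qconj (q + 1) * (q + 1) = N *: 1.
  by apply: quatP; rewrite !qxM c0 c1 c2 c3 /N /qn !qxE; ring.
rewrite mulr_algl scalerA => /eqP; rewrite scaler_eq0 => /orP[|/eqP//].
by rewrite gt_eqF// !mulr_gt0 ?invr_gt0.
Qed.

(** The reflection q |-> - q preserves regularity and exchanges the two sides. *)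
Lemma regular_flat F : (forall q, differentiable F q /\ fueter_op F q = 0) ->
  (forall q, qx0 q = 0 -> F q = 0) -> forall q, F q = 0.
Proof.
move=> rF F0 q; have [q0|q0|q0] := ltgtP (qx0 q) 0; last exact: F0; last first.
  exact: (regular_flat_pos rF F0).
pose G p := F (- p).
have dopp p : differentiable (-%R : quat R -> quat R) p.
  by apply: differentiableN; exact: ex_diff.
have rG p : differentiable G p /\ fueter_op G p = 0.
  have [dF fF] := rF (- p).
  have dG : differentiable G p by exact: (differentiable_comp (dopp p) dF).
  split; first exact: dG.
  have D v : 'D_v G p = - 'D_v F (- p).
    rewrite (@derive_val _ _ _ _ _ _ _ (is_derive_comp dF (dopp p) (is_deriveNid p v))).
    by rewrite linearN deriveE.
  by rewrite /fueter_op !D !mulrN -!opprD -/(fueter_op F (- p)) fF oppr0.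
have G0 p : qx0 p = 0 -> G p = 0 by move=> p0; apply: F0; rewrite qxE p0 oppr0.
have := regular_flat_pos rG G0 (q := - q); rewrite qxE oppr_gt0 => /(_ q0).
by rewrite /G opprK.
Qed.

Lemma fueter_sub (p1 p2 p3 a0 a1 a2 a3 b0 b1 b2 b3 : quat R) :
  a0 - b0 + p1 * (a1 - b1) + p2 * (a2 - b2) + p3 * (a3 - b3) =
  a0 + p1 * a1 + p2 * a2 + p3 * a3 - (b0 + p1 * b1 + p2 * b2 + p3 * b3).
Proof.
have E (u v c d : quat R) : (u - v) + (c - d) = (u + c) - (v + d).
  by rewrite opprD addrACA.
by rewrite !mulrBr !E.
Qed.

Lemma ck_extension_unique phi F1 F2 : is_ck_extension phi F1 ->
  is_ck_extension phi F2 -> F1 = F2.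
Proof.
move=> [[_ r1] e1] [[_ r2] e2]; apply/funext => q; apply/eqP; rewrite -subr_eq0; apply/eqP.
apply: (@regular_flat (fun p => F1 p - F2 p)) => p.
  have [d1 f1] := r1 p I; have [d2 f2] := r2 p I.
  have dd : differentiable (F1 - F2) p by exact: differentiableB.
  have dB v : 'd (F1 - F2) p v = 'd F1 p v - 'd F2 p v.
    exact: (congr1 (fun h => h v) (diffB d1 d2)).
  split; first exact: dd.
  pose Phi (d : quat R -> quat R) :=
    d 1 + qi R * d (qi R) + qj R * d (qj R) + qk R * d (qk R).
  apply: (etrans (etrans (fueter_opE dd) (congr1 Phi (funext dB)))).
  apply: (etrans (fueter_sub _ _ _ _ _ _ _ _ _ _ _)).
  apply/eqP; rewrite subr_eq0; apply/eqP.
  apply: (etrans (etrans (esym (fueter_opE d1)) f1)).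
  exact: (esym (etrans (esym (fueter_opE d2)) f2)).
by move=> p0; rewrite e1// e2// subrr.
Qed.

End CKUniqueness.

(** * Regularity of the Fueter polynomials *)

Section FueterPolynomials.
Variable R : realType.
Implicit Types (q v : quat R) (k : nat).

(** Multiplication by z on power series given by their coefficients. *)
Definition prev (X : nat -> R) k : R := if k is j.+1 then X j else 0.

(** The coefficients of src(z) / (1 - r z + n z^2). *)
Fixpoint recur (src : nat -> R) (r n : R) k : R :=
  match k with
  | 0 => src 0
  | k1.+1 => match k1 with
    | 0 => r * src 0 + src 1
    | k2.+1 => r * recur src r n k1 - n * recur src r n k2 + src k
    end
  end.

Lemma recurE src r n k : recur src r n k =
  r * prev (recur src r n) k - n * prev (prev (recur src r n)) k + src k.
Proof.
by case: k => [|[|k]] //=; rewrite ?mulr0 ?subr0 ?add0r.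
Qed.

(** For r = q + conj q and n = |q|^2 these are the coefficients of the first three
    powers of (1 - q z)^-1 (1 - conj q z)^-1. *)
Definition hsym q := recur (fun j => (j == 0)%:R) (2 * qx0 q) (qn q).
Definition usym q := recur (hsym q) (2 * qx0 q) (qn q).
Definition wsym q := recur (usym q) (2 * qx0 q) (qn q).

Lemma prev_derive (f : quat R -> nat -> R) (df : nat -> R) q v k :
  (forall j, (j < k)%N -> is_derive q v (fun p => f p j) (df j)) ->
  is_derive q v (fun p => prev (f p) k) (prev df k).
Proof. by case: k => [_|k]; [exact: is_derive_cst|apply]. Qed.

(** Differentiation of [recurE], where the derivative of r is 2 v0 and that of n
    is 2 <q, v>. *)
Lemma is_derive_recur (src : quat R -> nat -> R) (dsrc : nat -> R) (dX : nat -> R) q v :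
  (forall j, is_derive q v (fun p => src p j) (dsrc j)) ->
  (forall j, dX j = 2 * qx0 v * prev (recur (src q) (2 * qx0 q) (qn q)) j +
     2 * qx0 q * prev dX j -
     (2 * qdot q v * prev (prev (recur (src q) (2 * qx0 q) (qn q))) j +
      qn q * prev (prev dX) j) + dsrc j) ->
  forall k, is_derive q v (fun p => recur (src p) (2 * qx0 p) (qn p) k) (dX k).
Proof.
move=> hs hX; elim/ltn_ind => k IH.
have h1 : is_derive q v (fun p => prev (recur (src p) (2 * qx0 p) (qn p)) k) (prev dX k).
  exact: prev_derive.
have h2 : is_derive q v (fun p => prev (prev (recur (src p) (2 * qx0 p) (qn p))) k)
    (prev (prev dX) k).
  apply: (prev_derive (f := fun p => prev (recur (src p) (2 * qx0 p) (qn p)))) => j jk.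
  by apply: prev_derive => i ij; apply: IH; exact: ltn_trans jk.
have [h0 _ _ _] := is_derive_qx q v; have hn := is_derive_qn q v.
have hr : is_derive q v (fun p => 2 * qx0 p) (2 * qx0 v).
  by apply: is_derive_eq; rewrite /GRing.scale /= ?mulr0 ?addr0.
have := is_deriveD (is_deriveB (is_deriveM hr h1) (is_deriveM hn h2)) (hs k).
move=> H; rewrite (_ : (fun p => _) = fun p =>
  2 * qx0 p * prev (recur (src p) (2 * qx0 p) (qn p)) k -
  qn p * prev (prev (recur (src p) (2 * qx0 p) (qn p))) k + src p k); last first.
  by apply/funext => p; rewrite recurE.
by apply: is_derive_eq H _; rewrite hX /GRing.scale /=; ring.
Qed.

Lemma prev_lin (a b : R) X Y :
  prev (fun j => a * X j - b * Y j) = (fun k => a * prev X k - b * prev Y k).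
Proof. by apply/funext; case=> //=; rewrite !mulr0 subrr. Qed.

Lemma recur_prev src r n k : let X := recur src r n in
  prev X k = r * prev (prev X) k - n * prev (prev (prev X)) k + prev src k.
Proof.
case: k => [|k] /=; first by rewrite !mulr0 subrr addr0.
exact: recurE.
Qed.

Lemma recur_prev2 src r n k : let X := recur src r n in
  prev (prev X) k = r * prev (prev (prev X)) k - n * prev (prev (prev (prev X))) k +
    prev (prev src) k.
Proof.
case: k => [|k] /=; first by rewrite !mulr0 subrr addr0.
exact: recur_prev.
Qed.

(** If D = 1 - r z + n z^2, the derivative of 1/D is (2 v0 z - 2 <q, v> z^2) / D^2. *)
Lemma is_derive_hsym q v k : is_derive q v (fun p => hsym p k)
  (2 * qx0 v * prev (usym q) k - 2 * qdot q v * prev (prev (usym q)) k).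
Proof.
apply: (is_derive_recur (dsrc := fun=> 0) (dX := fun k =>
  2 * qx0 v * prev (usym q) k - 2 * qdot q v * prev (prev (usym q)) k)).
  by move=> j; exact: is_derive_cst.
move=> j; rewrite -/(hsym q) !prev_lin.
have e1 := recur_prev (hsym q) (2 * qx0 q) (qn q) j.
have e2 := recur_prev2 (hsym q) (2 * qx0 q) (qn q) j.
rewrite /= -/(usym q) in e1 e2.
by rewrite e1 e2; ring.
Qed.

(** The derivative of 1/D^2 is (4 v0 z - 4 <q, v> z^2) / D^3. *)
Lemma is_derive_usym q v k : is_derive q v (fun p => usym p k)
  (4 * qx0 v * prev (wsym q) k - 4 * qdot q v * prev (prev (wsym q)) k).
Proof.
apply: (is_derive_recur (dX := fun k =>
  4 * qx0 v * prev (wsym q) k - 4 * qdot q v * prev (prev (wsym q)) k)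
  (fun j => is_derive_hsym q v j)).
move=> j; rewrite -/(usym q) !prev_lin.
have e1 := recur_prev (usym q) (2 * qx0 q) (qn q) j.
have e2 := recur_prev2 (usym q) (2 * qx0 q) (qn q) j.
rewrite /= -/(wsym q) in e1 e2.
by rewrite e1 e2; ring.
Qed.

Lemma differentiable_prev (f : quat R -> nat -> R) q k :
  (forall j, (j < k)%N -> differentiable (fun p => f p j) q) ->
  differentiable (fun p => prev (f p) k) q.
Proof. by case: k => [_|k]; [exact: differentiable_cst|apply]. Qed.

Lemma differentiable_recur (src : quat R -> nat -> R) q :
  (forall j, differentiable (fun p => src p j) q) ->
  forall k, differentiable (fun p => recur (src p) (2 * qx0 p) (qn p) k) q.
Proof.
move=> hs; elim/ltn_ind => k IH.
pose X p := recur (src p) (2 * qx0 p) (qn p).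
have h1 : differentiable (fun p => prev (X p) k) q by exact: differentiable_prev.
have h2 : differentiable (fun p => prev (prev (X p)) k) q.
  apply: (differentiable_prev (f := fun p => prev (X p))) => j jk.
  by apply: differentiable_prev => i ij; apply: IH; exact: ltn_trans jk.
have h0 : differentiable (cst 2 * @qx0 R) q.
  apply: differentiableM; first exact: differentiable_cst.
  exact: differentiable_coord.
rewrite (_ : (fun p => _) = (cst 2 * @qx0 R) * (fun p => prev (X p) k) -
  @qn R * (fun p => prev (prev (X p)) k) + (fun p => src p k)); last first.
  by apply/funext => p; rewrite recurE.
apply: (differentiableD _ (hs k)); apply: differentiableB.
  exact: differentiableM.
apply: differentiableM => //; exact: differentiable_qn.
Qed.

Lemma differentiable_usym q k : differentiable (fun p => usym p k) q.
Proof.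
apply: differentiable_recur => j; apply: differentiable_recur => i.
exact: differentiable_cst.
Qed.

(** The coefficient of z^k in (1 - conj q z) / (1 - r z + n z^2)^2. *)
Definition fpoly k q : quat R := usym q k *: 1 - prev (usym q) k *: qconj q.

(** In generating functions, with D = 1 - r z + n z^2, the operator yields
    (4 z / D^3) (1 - q z - z conj q + n z^2 - D), which is 0; in coefficients this is
    the recurrence satisfied by [wsym]. *)
Lemma fpoly_regular k q : differentiable (fpoly k) q /\ fueter_op (fpoly k) q = 0.
Proof.
have du := differentiable_usym q k.
have dp : differentiable (fun p => prev (usym p) k) q.
  by apply: differentiable_prev => j _; exact: differentiable_usym.
have d1 : differentiable (fun p => usym p k *: (1 : quat R)) q.
  by apply: differentiable_scale => //; exact: differentiable_cst.
have d2 : differentiable (fun p => prev (usym p) k *: qconj p) q.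
  by apply: differentiable_scale => //; exact: differentiable_qconj.
split; first exact: (differentiableB d1 d2).
have D v : is_derive q v (fpoly k)
   ((4 * qx0 v * prev (wsym q) k - 4 * qdot q v * prev (prev (wsym q)) k) *: 1 -
    ((4 * qx0 v * prev (prev (wsym q)) k -
      4 * qdot q v * prev (prev (prev (wsym q))) k) *: qconj q +
     prev (usym q) k *: qconj v)).
  have h1 := is_derive_usym q v k.
  have h2 : is_derive q v (fun p => prev (usym p) k)
     (4 * qx0 v * prev (prev (wsym q)) k - 4 * qdot q v * prev (prev (prev (wsym q))) k).
    have := prev_derive (f := usym) (k := k) (fun j _ => is_derive_usym q v j).
    by rewrite prev_lin.
  have := is_deriveB (is_derive_scale h1 (is_derive_cst (1 : quat R) q v))
    (is_derive_scale h2 (is_derive_qconj q v)).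
  by rewrite scaler0 addr0.
have {}D v : 'D_v (fpoly k) q = _ := @derive_val _ _ _ _ _ _ _ (D v).
rewrite /fueter_op !D.
have [-> -> -> ->] := qdot_units q; have [-> -> -> ->] := qconj_units R.
rewrite !qx_1.
have [i0 i1 i2 i3] := qx_qi R; have [j0 j1 j2 j3] := qx_qj R.
have [k0 k1 k2 k3] := qx_qk R; have [c0 c1 c2 c3] := qx_qconj q.
rewrite i0 j0 k0.
have := recur_prev (usym q) (2 * qx0 q) (qn q) k.
rewrite /= -/(wsym q).
move: (prev (wsym q) k) (prev (prev (wsym q)) k) (prev (prev (prev (wsym q))) k)
  (prev (usym q) k) => w1 w2 w3 u1 e.
move: (qconj q) c0 c1 c2 c3 => Y c0 c1 c2 c3.
move: (qi R) (qj R) (qk R) i0 i1 i2 i3 j0 j1 j2 j3 k0 k1 k2 k3 =>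
  I J K i0 i1 i2 i3 j0 j1 j2 j3 k0 k1 k2 k3.
have Ec := (i0, i1, i2, i3, j0, j1, j2, j3, k0, k1, k2, k3, c0, c1, c2, c3).
by apply: quatP; rewrite !(qxM, qxD, qxN, qxZ, qx_1, qx_0) !Ec e /qn; ring.
Qed.

End FueterPolynomials.

(** * The Cauchy-Kowalevskaya product *)

Section CompleteSums.
Variables (R : realType) (A : algType R) (a b : A) (r n : R).
Hypotheses (ab_sum : a + b = r%:A) (ba_prod : b * a = n%:A) (ab_prod : a * b = n%:A).

Let h := recur (fun j => (j == 0)%:R) r n.
Let u := recur h r n.

Let hterm k : A := \sum_(j < k.+1) a ^+ (k - j) * b ^+ j.

Definition weighted_sum k : A := \sum_(j < k.+1) (k - j).+1%:R *: (a ^+ (k - j) * b ^+ j).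

Let htermS k : hterm k.+1 = a * hterm k + b ^+ k.+1.
Proof.
rewrite /hterm big_ord_recr /= subnn expr0 mul1r mulr_sumr; congr (_ + _).
by apply: eq_bigr => j _; rewrite subSn ?exprS ?mulrA// -ltnS.
Qed.

Let weighted_sumS k : weighted_sum k.+1 = a * weighted_sum k + hterm k.+1.
Proof.
rewrite /weighted_sum /hterm mulr_sumr [X in _ = _ + X]big_ord_recr.
rewrite [in LHS]big_ord_recr /=.
rewrite subnn scale1r addrA -big_split /=; congr (_ + _); apply: eq_bigr => j _.
rewrite subSn; last by rewrite -ltnS.
rewrite -[_.+2]addn1 natrD scalerDl scale1r; congr (_ + _).
by rewrite -scalerAr mulrA -exprS.
Qed.

Let htermE k : hterm k = (h k)%:A.
Proof.
have h0 : hterm 0 = 1 by rewrite /hterm big_ord1 subnn !expr0 mul1r.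
have h1 : hterm 1 = r%:A by rewrite htermS h0 mulr1 expr1 ab_sum.
have hSS j : hterm j.+2 = r *: hterm j.+1 - n *: hterm j.
  rewrite htermS exprS.
  have -> : b ^+ j.+1 = hterm j.+1 - a * hterm j by rewrite htermS addrC addKr.
  by rewrite mulrBr addrA -mulrDl ab_sum mulrA ba_prod !mulr_algl.
suff: hterm k = (h k)%:A /\ hterm k.+1 = (h k.+1)%:A by case.
elim: k => [|k [IH1 IH2]].
  by rewrite h0 h1 /h /= scale1r mulr1 addr0.
split=> //; rewrite hSS IH1 IH2 !scalerA -scalerBl; congr (_ *: _).
exact: esym (etrans (recurE _ _ _ k.+2) (addr0 _)).
Qed.

(** The sum is the coefficient of z^k in (1 - a z)^-2 (1 - b z)^-1, which equals
    (1 - b z) / (1 - r z + n z^2)^2 when a + b = r and a b = n are central. *)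
Lemma weighted_sumE k : weighted_sum k = (u k)%:A - prev u k *: b.
Proof.
elim: k => [|k IH].
  by rewrite /weighted_sum big_ord1 subnn !expr0 mul1r /= scale0r subr0.
rewrite weighted_sumS IH htermE /=.
have -> : u k.+1 = r * u k - n * prev u k + h k.+1 by rewrite /u recurE.
rewrite mulrBr -!scalerAr mulr1 ab_prod scalerA.
have -> : a = r%:A - b by rewrite -ab_sum addrK.
rewrite scalerBr scalerA [in RHS]scalerDl [in RHS]scalerBl (mulrC r) (mulrC n).
have E (x y z w : A) : x - y - z + w = x - z + w - y by rewrite (addrAC x (- y) (- z)) (addrAC (x - z) (- y) w).
exact: E.
Qed.

End CompleteSums.

Section AlternatingCoefficients.
Variable R : realType.

Lemma coefT_E k j : coefT R k j = 2 / ((k + 1) * (k + 2))%:R * (k - j).+1%:R.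
Proof. by rewrite /coefT natrM addn1 mulrAC. Qed.

(** Up to a positive factor, c_l is S_l = (l+1) - l + (l-1) - ... The relation
    S_(l+1) = (l+2) - S_l keeps it between 0 and l+1. *)
Lemma coefc_gt0 l : 0 < coefc R l.
Proof.
pose S l : R := \sum_(j < l.+1) (-1) ^+ j * (l - j).+1%:R.
have -> : coefc R l = 2 / ((l + 1) * (l + 2))%:R * S l.
  rewrite /coefc /S mulr_sumr; apply: eq_bigr => j _.
  by rewrite coefT_E mulrCA.
have S_step m : S m.+1 = m.+2%:R - S m.
  rewrite /S big_ord_recl /= expr0 mul1r subn0; congr (_ + _).
  rewrite -sumrN; apply: eq_bigr => j _.
  by rewrite /bump /= add1n subSS exprS -mulrA mulN1r.
have [S0 _] : 0 < S l /\ S l <= l.+1%:R.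
  elim: l => [|l [IH1 IH2]]; first by rewrite /S big_ord1 expr0 mul1r ltr01 lexx.
  rewrite S_step subr_gt0; split; last by rewrite lerBlDr lerDl ltW.
  by apply: (le_lt_trans IH2); rewrite ltr_nat.
by rewrite mulr_gt0// divr_gt0// ltr0n muln_gt0 addn1 addn2.
Qed.

End AlternatingCoefficients.

Section FueterPolynomialsFacts.
Variable R : realType.
Implicit Types (q : quat R) (k : nat).

Lemma polyQE k q : polyQ k q = (2 / ((k + 1) * (k + 2))%:R) *: fpoly k q.
Proof.
have sumE : q + qconj q = (2 * qx0 q)%:A.
  have [c0 c1 c2 c3] := qx_qconj q.
  by apply: quatP; rewrite qxD ?c0 ?c1 ?c2 ?c3 qxZ qx_1; ring.
have prodE : qconj q * q = (qn q)%:A.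
  have [c0 c1 c2 c3] := qx_qconj q.
  by apply: quatP; rewrite qxM c0 c1 c2 c3 qxZ qx_1 /qn; ring.
have prodE' : q * qconj q = (qn q)%:A.
  have [c0 c1 c2 c3] := qx_qconj q.
  by apply: quatP; rewrite qxM c0 c1 c2 c3 qxZ qx_1 /qn; ring.
rewrite /fpoly -(weighted_sumE sumE prodE prodE') /polyQ /weighted_sum scaler_sumr.
by apply: eq_bigr => j _; rewrite coefT_E scalerA.
Qed.

Lemma scale_regular (F : quat R -> quat R) (t : R) q :
  differentiable F q /\ fueter_op F q = 0 ->
  differentiable (fun p => t *: F p) q /\ fueter_op (fun p => t *: F p) q = 0.
Proof.
move=> [dF fF].
split; first exact: (differentiable_scale (differentiable_cst t q) dF).
have D v : 'D_v (fun p => t *: F p) q = t *: 'D_v F q.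
  have h := derivableP (diff_derivable (v := v) dF).
  have := is_derive_scale (is_derive_cst t q v) h.
  by rewrite scale0r add0r => /(@derive_val _ _ _ _ _ _ _).
pose Phi (d : quat R -> quat R) :=
  d 1 + qi R * d (qi R) + qj R * d (qj R) + qk R * d (qk R).
apply: (etrans (congr1 Phi (funext D))).
have E (p1 p2 p3 q0 q1 q2 q3 : quat R) :
    t *: q0 + p1 * (t *: q1) + p2 * (t *: q2) + p3 * (t *: q3) =
    t *: (q0 + p1 * q1 + p2 * q2 + p3 * q3) by rewrite -!scalerAr -!scalerDr.
apply: (etrans (E _ _ _ _ _ _ _)).
by apply: (etrans (congr1 _ fF)); exact: scaler0.
Qed.

Lemma polyQ_regular k q :
  differentiable (polyQ k) q /\ fueter_op (polyQ k) q = 0.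
Proof.
have -> : polyQ k = (fun p : quat R => (2 / ((k + 1) * (k + 2))%:R) *: fpoly k p : quat R).
  by apply: funext => p; exact: polyQE.
by apply: scale_regular; exact: fpoly_regular.
Qed.

Lemma signed_power (A : algType R) (a : A) k j : (j <= k)%N ->
  a ^+ (k - j) * (- a) ^+ j = (-1) ^+ j *: a ^+ k.
Proof.
by move=> jk; rewrite -scaleN1r exprZn -scalerAr -exprD subnK.
Qed.

Lemma polyQ_imaginary k q : qx0 q = 0 -> polyQ k q = coefc R k *: q ^+ k.
Proof.
move=> q0; have qE : qconj q = - q.
  have [c0 c1 c2 c3] := qx_qconj q.
  by apply: quatP; rewrite ?c0 ?c1 ?c2 ?c3 qxN// q0 oppr0.
rewrite /polyQ /coefc scaler_suml; apply: eq_bigr => j _.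
have jk : (j <= k)%N by rewrite -ltnS.
by rewrite qE (signed_power _ jk) scalerA mulrC.
Qed.

Lemma ck_extension_eq (phi F : quat R -> quat R) :
  is_ck_extension phi F -> ck_extension phi = F.
Proof.
move=> ckF; apply: xget_unique.
  by split=> // G ckG; exact: ck_extension_unique ckF ckG.
by move=> G [ckG _]; exact: ck_extension_unique ckG ckF.
Qed.

End FueterPolynomialsFacts.

Theorem proposition3p7 (R : realType) (k s : nat) (q : quat R) :
  ck_product (@polyQ R k) (@polyQ R s) q =
  (coefc R k * coefc R s / coefc R (k + s)) *: polyQ (k + s) q.
Proof.
pose F p := (coefc R k * coefc R s / coefc R (k + s)) *: polyQ (k + s) p.
have ckF : is_ck_extension (fun p => polyQ k p * polyQ s p) F.
  split.
    by split=> [|p _]; [exact: openT|exact/scale_regular/polyQ_regular].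
  move=> p p0; rewrite /F !(polyQ_imaginary _ p0) scalerA.
  have c0 : coefc R (k + s) != 0 by rewrite gt_eqF// coefc_gt0.
  by rewrite (divfK c0) exprD -scalerAl -scalerAr scalerA.
by rewrite /ck_product (ck_extension_eq ckF).
Qed.
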